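(* For all integers $l\ge1$ and $n\ge0$, with $N=n+\tfrac34$, $$0<(-1)^{l+1}\varepsilon_l(N)=\left|\varepsilon_l(N)\right|<\frac{\left|\beta_{2l}\right|}{N^{2l}}=\frac{(-1)^{l+1}\beta_{2l}}{N^{2l}},$$ where $$\varepsilon_l(N)=\pi G_n-\left\{\ln N+\gamma+4\ln 2+\sum_{s=1}^{l-1}\frac{\beta_{2s}}{N^{2s}}\right\},$$ $G_n$ is the $n$-th Landau constant, $\gamma$ is Euler's constant, and the numbers $\beta_{2s}$ are those defined recursively in the context. That is, the error due to truncation of the asymptotic expansion $\pi G_n\sim\ln N+\gamma+4\ln2+\sum_{s\ge1}\beta_{2s}N^{-2s}$ is bounded in absolute value by, and of the same sign as, the first neglected term, for all nonnegative $n$.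
   Context: Landau constants: $G_0=1$ and, for $n\ge1$, $$G_n=1+\left(\frac12\right)^2+\left(\frac{1\cdot3}{2\cdot4}\right)^2+\cdots+\left(\frac{1\cdot3\cdots(2n-1)}{2\cdot4\cdots(2n)}\right)^2.$$ Euler's constant is $\gamma=0.5772\cdots$. An empty sum (the case $l=1$) is $0$. Coefficients $d_{j,s}$: for integers $j\ge1$, $d_{j,j+1}=4j^2$ and, for $s\ge j+2$, $$d_{j,s}=\frac{(2s+2j-2)\,(2s-2)!}{(2s-2j)!\,(2j-1)!}+\frac{(2s-3)!}{8\,(2s-2j-2)!\,(2j-1)!};$$ and for $s\ge2$, $$d_{0,s}=\left(\frac1s-\frac1{2s-1}\right)+\frac1{16(s-1)}.$$ The numbers $\beta_{2k}$ ($k=1,2,\dots$) are defined recursively by $$\beta_{2k}=\frac{-1}{4k^2}\left(\sum_{j=1}^{k-1}d_{j,k+1}\,\beta_{2j}-d_{0,k+1}\right),$$ so e.g. $\beta_2=\frac{11}{192}$, $\beta_4=-\frac{1541}{122880}$. *)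

(* Defs.v *)
(* Stdlib reals with Coquelicot.  Finite sums are Coquelicot's [sum_n_m f a b],
   the sum of [f] over [a <= i <= b], which is 0 when [b < a]. *)
From Stdlib Require Import Reals Lra Lia Arith.
From Coquelicot Require Import Coquelicot.
Open Scope R_scope.

(* (1 * 3 * ... * (2k-1)) / (2 * 4 * ... * (2k)), equal to 1 for k = 0. *)
Fixpoint odd_even_ratio (k : nat) : R :=
  match k with
  | O => 1
  | S k' => odd_even_ratio k' * ((2 * INR k - 1) / (2 * INR k))
  end.

Definition landau (n : nat) : R :=
  sum_n_m (fun k => odd_even_ratio k ^ 2) 0 n.

Definition euler_gamma : R :=
  real (Lim_seq (fun n => sum_n_m (fun k => 1 / INR k) 1 n - ln (INR n))).

(* Meaningful for j = 0, s >= 2 and for j >= 1, s >= j + 1; the natural-number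
   subtractions are exact in that range.  Other values are junk. *)
Definition d (j s : nat) : R :=
  if (j =? 0)%nat then
    (1 / INR s - 1 / (2 * INR s - 1)) + 1 / (16 * (INR s - 1))
  else if (s =? j + 1)%nat then
    4 * INR j ^ 2
  else
    (2 * INR s + 2 * INR j - 2) * INR (fact (2 * s - 2))
      / (INR (fact (2 * s - 2 * j)) * INR (fact (2 * j - 1)))
    + INR (fact (2 * s - 3))
      / (8 * INR (fact (2 * s - 2 * j - 2)) * INR (fact (2 * j - 1))).

(* [beta_table k] holds the values of beta_{2j} for 1 <= j <= k, so that the
   course-of-values recursion becomes structural. *)
Fixpoint beta_table (k : nat) : nat -> R :=
  match k with
  | O => fun _ => 0
  | S k' => fun i =>
      if (i =? k)%nat then
        -1 / (4 * INR k ^ 2)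
        * (sum_n_m (fun j => d j (k + 1) * beta_table k' j) 1 (k - 1)
           - d 0 (k + 1))
      else beta_table k' i
  end.

(* [beta2 k] is beta_{2k}, for k >= 1; [beta2_rec] is its defining recursion. *)
Definition beta2 (k : nat) : R := beta_table k k.

Lemma beta_table_stable (k j : nat) :
  (j <= k)%nat -> beta_table k j = beta2 j.
Proof.
induction k as [|k IH]; intros Hj.
- now replace j with 0%nat by lia.
- destruct (Nat.eq_dec j (S k)) as [->|Hne]; [reflexivity|].
  cbn [beta_table].
  rewrite (proj2 (Nat.eqb_neq j (S k)) Hne).
  apply IH; lia.
Qed.

Lemma beta2_rec (k : nat) :
  (1 <= k)%nat ->
  beta2 k =
    -1 / (4 * INR k ^ 2)
    * (sum_n_m (fun j => d j (k + 1) * beta2 j) 1 (k - 1) - d 0 (k + 1)).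
Proof.
intros Hk; destruct k as [|k]; [lia|].
unfold beta2 at 1; cbn [beta_table].
rewrite Nat.eqb_refl.
f_equal; f_equal.
apply sum_n_m_ext_loc; intros j Hj.
rewrite beta_table_stable by lia; reflexivity.
Qed.

Lemma beta2_1 : beta2 1 = 11 / 192.
Proof.
rewrite beta2_rec by lia.
rewrite sum_n_m_zero by lia.
unfold d, zero; simpl; lra.
Qed.

Lemma beta2_2 : beta2 2 = - 1541 / 122880.
Proof.
rewrite beta2_rec by lia.
change (2 - 1)%nat with 1%nat.
rewrite sum_n_n, beta2_1.
unfold d; simpl; lra.
Qed.

(* Main.v *)
Require Import Defs.
From Stdlib Require Import Reals Lra Lia Arith FunctionalExtensionality.
From Coquelicot Require Import Coquelicot.
Open Scope R_scope.

(** Write [a_k] for the square of [(1*3*...*(2k-1))/(2*4*...*(2k))], [N = n + 3/4],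
and [S_l] for the expansion truncated before the term of index [l], constants
omitted.

Since [(n+1)^2 a_(n+1) = (n+1/2)^2 a_n], the Landau constants are annihilated
by the operator [diff_op], whose coefficients [(N + 1/4)^2] and [(N - 1/4)^2]
are symmetric about [N].  Applied to [ln N] and to [N^(-2j)] it gives series
in [1/N^2] whose coefficients are the [d j s]
([diff_op_ln_series], [diff_op_pow_series]); the recursion for [beta2] says
exactly that the coefficients of [diff_op S_l] vanish up to index [l - 1]
([residual_vanishes]).  The heart of the proof is that all the remaining ones
have the sign [(-1)^l] ([residual_sign]), so that [diff_op S_l] itself has this
sign for every [N > 1] ([diff_op_expansion_sign]).

From there the sign of the error follows by monotonicity.  Let [eps] be the
error and [delta] its forward difference.  Reduction of order, with the
solution [landau] of the homogeneous equation, turns the second-order equation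
for [eps] into a first-order one for [delta_n / a_(n+1)]: this quotient is
monotone ([scaled_increment_step]) and tends to 0, which determines its sign
and thus the direction in which [eps] moves; as [eps] also tends to 0, its sign
is [(-1)^(l+1)] ([truncation_error_sign]).  The error for [l + 1] is the error
for [l] minus the first omitted term and has the opposite sign; hence the
omitted term has the sign of the error and exceeds it.

Why the residual coefficients have one sign.  Up to a common factor the
coefficient of index [n] is [sum_(j < l) (-1)^j a_j], with
[a_j = weight n (n-j) * B_j], where [B_0 = 1] and
[B_j = |beta2 j| / (2j-1)!] for [j >= 1] ([beta2_closed]).
The complete sum over [j <= n] is zero.  If [48 B_(j+1) > B_j > 0] then
[a_0 < a_1 < ... < a_(n-2)], because the weights grow by a factor 48 at least
while [n - j >= 3]; so a partial sum that stops at [n - 2] or before has the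
sign of its last term, and the one that stops at [n - 1] has the sign opposite
to the last term of the complete sum.

Why [B] is positive with that growth.  The equation satisfied by [B] is the
coefficient form of Legendre's equation: with [z = y^2],
[sum_j B_j z^j = (y/2) / sin (y/2) * P(cos (y/2))], where [P] is the Legendre
function of degree -1/2.  The sign changes that hide the positivity of
[beta2] disappear in the two factors, since [1 - (y/2) cot (y/2)] has positive
coefficients by its Riccati equation, and both factors solve linear equations
driven by it.  All this is done with formal power series in [z]
([legendre_coefficients]).

The constant [euler_gamma + 4 ln 2] comes from Wallis integrals: with [c_k] the
square root of [a_k], [PI c_k / 2] is the integral of [sin^(2k)] over
[[0, PI/2]].  Replacing [sin^(2k)] by [sin^(2k+1)] turns [PI a_k] into
[2/(2k+1)], whose sums are harmonic, and the corrections add up to [2 ln 2]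
in the limit ([landau_decomposition], [landau_log_limit]). *)

(** * Formal power series *)

(** [ring] and [field] recognise the reals only if the equality is syntactically
at type [R], not at the carrier of one of the Coquelicot structures. *)
Ltac real_eq := match goal with |- @eq _ ?a ?b => change (@eq R a b) end.

Notation fps := (nat -> R).
Definition fzero : fps := fun _ => 0.
Definition fone : fps := fun n => match n with O => 1 | S _ => 0 end.
Definition fadd (f g : fps) : fps := fun n => f n + g n.
Definition fopp (f : fps) : fps := fun n => - f n.
Definition fsub (f g : fps) : fps := fun n => f n - g n.
Definition ftail (f : fps) : fps := fun n => f (S n).

(** The Cauchy product, by recursion on the degree rather than as a sum: the ring
axioms, the Leibniz rule and the comparison lemmas then follow by induction on
the degree without any exchange of summations. *)
Fixpoint fmul (f g : fps) (n : nat) : R :=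
  match n with
  | O => f O * g O
  | S m => f O * g (S m) + fmul (ftail f) g m
  end.

(** The Euler operator [z d/dz]. *)
Definition theta (f : fps) : fps := fun n => INR n * f n.

(** The series [z/4]; the quarter keeps all the differential equations below free
of fractions, so that [ring] applies to them. *)
Definition zeta : fps := fun n => match n with 1%nat => / 4 | _ => 0 end.

Lemma fmul_ext (f f' g g' : fps) (n : nat) :
  (forall k, (k <= n)%nat -> f k = f' k) ->
  (forall k, (k <= n)%nat -> g k = g' k) ->
  fmul f g n = fmul f' g' n.
Proof.
revert f f'; induction n as [|n IH]; intros f f' Hf Hg; simpl.
- rewrite Hf, Hg by lia; reflexivity.
- rewrite (Hf O), (Hg (S n)) by lia; f_equal.
  apply IH; intros k Hk; [apply Hf | apply Hg]; lia.
Qed.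

Lemma fmul_addl (f g h : fps) (n : nat) :
  fmul (fadd f g) h n = fmul f h n + fmul g h n.
Proof.
revert f g; induction n as [|n IH]; intros f g; simpl.
- unfold fadd; ring.
- change (ftail (fadd f g)) with (fadd (ftail f) (ftail g)).
  rewrite IH; unfold fadd; ring.
Qed.

Lemma fmul_scall (c : R) (f g : fps) (n : nat) :
  fmul (fun k => c * f k) g n = c * fmul f g n.
Proof.
revert f; induction n as [|n IH]; intros f; simpl.
- ring.
- change (ftail (fun k => c * f k)) with (fun k => c * ftail f k).
  rewrite IH; ring.
Qed.

Lemma fmul_lastr (f g : fps) (n : nat) :
  fmul f g (S n) = fmul f (ftail g) n + f (S n) * g O.
Proof.
revert f; induction n as [|n IH]; intros f.
- simpl; unfold ftail; ring.
- change (fmul f g (S (S n)))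
    with (f O * g (S (S n)) + fmul (ftail f) g (S n)).
  rewrite IH; simpl; unfold ftail at 5; unfold ftail; ring.
Qed.

Lemma fmul_comm (f g : fps) : fmul f g = fmul g f.
Proof.
apply functional_extensionality; intros n.
revert f g; induction n as [|n IH]; intros f g.
- simpl; ring.
- rewrite fmul_lastr, IH; simpl; ring.
Qed.

Lemma fmul_assoc (f g h : fps) : fmul f (fmul g h) = fmul (fmul f g) h.
Proof.
apply functional_extensionality; intros n.
revert f; induction n as [|n IH]; intros f.
- simpl; ring.
- change (fmul f (fmul g h) (S n))
    with (f O * (g O * h (S n) + fmul (ftail g) h n)
          + fmul (ftail f) (fmul g h) n).
  change (fmul (fmul f g) h (S n))
    with (f O * g O * h (S n)
          + fmul (fadd (fun k => f O * ftail g k) (fmul (ftail f) g)) h n).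
  rewrite fmul_addl, fmul_scall, IH; ring.
Qed.

Lemma fmul_onel (f : fps) : fmul fone f = f.
Proof.
apply functional_extensionality; intros [|n]; simpl; [ring|].
replace (fmul (ftail fone) f n) with (fmul (fun k => 0 * fone k) f n).
- rewrite fmul_scall; ring.
- apply fmul_ext; intros; unfold ftail; simpl; ring.
Qed.

Lemma fps_ring : ring_theory fzero fone fadd fmul fsub fopp (@eq fps).
Proof.
constructor; intros;
  try (apply functional_extensionality; intros n;
       unfold fadd, fzero, fsub, fopp; ring).
- apply fmul_onel.
- apply fmul_comm.
- apply fmul_assoc.
- apply functional_extensionality; intros n; apply fmul_addl.
Qed.

Add Ring fps_ring_inst : fps_ring.

Declare Scope fps_scope.
Delimit Scope fps_scope with fps.
Notation "f + g" := (fadd f g) : fps_scope.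
Notation "f * g" := (fmul f g) : fps_scope.
Notation "f - g" := (fsub f g) : fps_scope.
Notation "- f" := (fopp f) : fps_scope.
Notation "1" := fone : fps_scope.
Notation "0" := fzero : fps_scope.
Notation "2" := (fadd fone fone) : fps_scope.

Lemma theta_add (f g : fps) : theta (f + g)%fps = (theta f + theta g)%fps.
Proof.
apply functional_extensionality; intros n; unfold theta, fadd; ring.
Qed.

Lemma theta_sub (f g : fps) : theta (f - g)%fps = (theta f - theta g)%fps.
Proof.
apply functional_extensionality; intros n; unfold theta, fsub; ring.
Qed.

Lemma theta_one : theta 1%fps = 0%fps.
Proof.
apply functional_extensionality; intros [|n]; unfold theta, fzero; simpl;
  ring.
Qed.

Lemma theta_zeta : theta zeta = zeta.
Proof.
apply functional_extensionality; intros [|[|n]]; unfold theta, zeta;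
  simpl; ring.
Qed.

Lemma theta_mul (f g : fps) :
  theta (f * g)%fps = (theta f * g + f * theta g)%fps.
Proof.
apply functional_extensionality; intros n.
revert f; induction n as [|n IH]; intros f.
- unfold theta, fadd; simpl; ring.
- change (theta (f * g)%fps (S n))
    with (INR (S n) * (f O * g (S n) + fmul (ftail f) g n)).
  specialize (IH (ftail f)); unfold theta at 1, fadd in IH.
  unfold fadd; simpl fmul.
  replace (fmul (ftail (theta f)) g n)
    with (fmul (theta (ftail f)) g n + fmul (ftail f) g n).
  + replace (theta f O) with 0 by (unfold theta; simpl; ring).
    replace (theta g (S n)) with (INR (S n) * g (S n)) by reflexivity.
    rewrite S_INR; lra.
  + rewrite <- fmul_addl; apply fmul_ext; intros k _; [|reflexivity].
    unfold fadd, ftail, theta; rewrite S_INR; ring.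
Qed.

Lemma zeta_mul (f : fps) (n : nat) :
  fmul zeta f n = match n with O => 0 | S m => / 4 * f m end.
Proof.
destruct n as [|n]; simpl; [ring|].
replace (fmul (ftail zeta) f n) with (fmul (fun k => / 4 * fone k) f n).
- rewrite fmul_scall, fmul_onel; ring.
- apply fmul_ext; intros [|k] _; unfold ftail; simpl; ring.
Qed.

Lemma fmul_sum (f g : fps) (n : nat) :
  fmul f g n = sum_n_m (fun j => f j * g (n - j)%nat) 0 n.
Proof.
revert f; induction n as [|n IH]; intros f.
- rewrite sum_n_n; reflexivity.
- rewrite sum_Sn_m by lia; rewrite <- sum_n_m_S.
  simpl fmul; rewrite IH; reflexivity.
Qed.

Lemma theta_eq_0 (f : fps) : theta f = 0%fps -> forall n, f (S n) = 0.
Proof.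
intros H n; apply (f_equal (fun h => h (S n))) in H.
unfold theta, fzero in H; apply Rmult_integral in H as [H|H]; [|exact H].
now apply not_0_INR in H.
Qed.

(** Recursions that use all earlier coefficients, often through a product, are
solved at once: iterating [F] settles one more coefficient at each step. *)
Lemma causal_fixpoint (F : fps -> fps) :
  (forall f g n, (forall k, (k < n)%nat -> f k = g k) -> F f n = F g n) ->
  exists f, forall n, f n = F f n.
Proof.
intros HF.
set (it := fun m => Nat.iter m F fzero).
assert (Hst : forall n m m', (n < m)%nat -> (n < m')%nat -> it m n = it m' n).
{ induction n as [n IH] using lt_wf_ind; intros [|m] [|m'] H H'; try lia.
  apply HF; intros k Hk; apply IH; lia. }
exists (fun n => it (S n) n); intros n.
change (F (it n) n = F (fun k => it (S k) k) n).
apply HF; intros k Hk; apply Hst; lia.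
Qed.

Lemma fmul_pos (f g : fps) (n : nat) :
  (forall k, (k <= n)%nat -> 0 < f k) -> (forall k, (k <= n)%nat -> 0 < g k) ->
  0 < fmul f g n.
Proof.
revert f; induction n as [|n IH]; intros f Hf Hg; simpl.
- apply Rmult_lt_0_compat; auto.
- apply Rplus_lt_0_compat.
  + apply Rmult_lt_0_compat; [apply Hf | apply Hg]; lia.
  + apply IH; intros k Hk; [apply Hf | apply Hg]; lia.
Qed.

Lemma fmul_le (f f' g : fps) (n : nat) :
  (forall k, (k <= n)%nat -> f k <= f' k) ->
  (forall k, (k <= n)%nat -> 0 <= g k) ->
  fmul f g n <= fmul f' g n.
Proof.
revert f f'; induction n as [|n IH]; intros f f' Hf Hg; simpl.
- apply Rmult_le_compat_r; auto.
- apply Rplus_le_compat.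
  + apply Rmult_le_compat_r; [apply Hg | apply Hf]; lia.
  + apply IH; intros k Hk; [apply Hf | apply Hg]; lia.
Qed.

(** * Series solutions around Legendre's equation *)

(** Coefficient form of [8 theta h + 12 h = 1 + 16 zeta h^2], the Riccati equation of
the cotangent: it says [z h = 1 - (y/2) cot (y/2)] for [z = y^2]. *)
Definition cot_recurrence (h : fps) : Prop := forall n,
  (8 * INR n + 12) * h n =
    fone n + match n with O => 0 | S m => 4 * fmul h h m end.

Lemma cot_series_exists : exists h : fps, cot_recurrence h.
Proof.
destruct (causal_fixpoint (fun h n =>
  (fone n + match n with O => 0 | S m => 4 * fmul h h m end)
    / (8 * INR n + 12))) as [h Hh].
- intros f g [|n] H; [reflexivity|].
  rewrite (fmul_ext f g f g n); [reflexivity| |];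
    intros k Hk; apply H; lia.
- exists h; intros n; rewrite Hh at 1.
  pose proof (pos_INR n); field; lra.
Qed.

(** The series [w = (y/2) / sin (y/2)], from its logarithmic derivative. *)
Lemma csc_series_exists (h : fps) : exists w : fps,
  w O = 1 /\ forall n, 2 * INR (S n) * w (S n) = fmul h w n.
Proof.
destruct (causal_fixpoint (fun w n => match n with O => 1
  | S m => fmul h w m / (2 * INR n) end)) as [w Hw].
- intros f g [|n] H; [reflexivity|].
  rewrite (fmul_ext h h f g n); [reflexivity|reflexivity|];
    intros k Hk; apply H; lia.
- exists w; split; [apply Hw|]; intros n; rewrite (Hw (S n)).
  field; apply not_0_INR; lia.
Qed.

(** The series [e = (2 - 2 cos y) / y^2], which is the square of
[sin (y/2) / (y/2)], again from its logarithmic derivative. *)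
Lemma sin_sq_series_exists (h : fps) : exists e : fps,
  e O = 1 /\ forall n, INR (S n) * e (S n) = - fmul h e n.
Proof.
destruct (causal_fixpoint (fun w n => match n with O => 1
  | S m => - fmul h w m / (INR n) end)) as [w Hw].
- intros f g [|n] H; [reflexivity|].
  rewrite (fmul_ext h h f g n); [reflexivity|reflexivity|];
    intros k Hk; apply H; lia.
- exists w; split; [apply Hw|]; intros n; rewrite (Hw (S n)).
  field; apply not_0_INR; lia.
Qed.

(** The series [p] of the Legendre function of degree -1/2 at [cos (y/2)].  Every
term on the right is positive if the coefficients of [h] are. *)
Lemma legendre_series_exists (h : fps) : exists p : fps,
  p O = 1 /\
  forall n, 16 * INR (S n) ^ 2 * p (S n) = 8 * fmul h (theta p) n + p n / 4.
Proof.
destruct (causal_fixpoint (fun p n => match n with O => 1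
  | S m => (8 * fmul h (theta p) m + p m / 4) / (16 * INR n ^ 2) end))
  as [p Hp].
- intros f g [|n] H; [reflexivity|].
  rewrite (fmul_ext h h (theta f) (theta g) n), (H n);
    [reflexivity|lia|reflexivity|].
  intros k Hk; unfold theta; rewrite H by lia; reflexivity.
- exists p; split; [apply Hp|]; intros n; rewrite (Hp (S n)).
  field; apply not_0_INR; lia.
Qed.

Section Legendre.
Local Open Scope fps_scope.

(** With [kappa = 1 - (y/2) cot (y/2)] the third hypothesis is Legendre's equation.
The conclusion is the equation that follows for [w * p], multiplied by [e]: in this
form the coefficient series are [e], [theta e] and [zeta * e], all known
explicitly. *)
Lemma legendre_identity (kappa e w p : fps) :
  theta e = - (kappa * e) ->
  2 * theta w = kappa * w ->
  2 * (2 * (2 * (2 * theta (theta p))))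
    = 2 * (2 * (2 * (kappa * theta p))) + zeta * p ->
  2 * (2 * (2 * (2 * theta (theta (e * (w * p))))))
    - 2 * (2 * (2 * theta (theta e * (w * p)))) = zeta * (e * (w * p)).
Proof.
intros He Hw Hp.
set (X := e * (w * p)); set (Y := e * (w * theta p)).
assert (HX : 2 * theta X = - (kappa * X) + 2 * Y).
{ unfold X, Y; rewrite !theta_mul, He.
  transitivity (- (2 * (kappa * e * (w * p))) + e * ((2 * theta w) * p)
                + 2 * (e * (w * theta p))); [ring|].
  rewrite Hw; ring. }
assert (HY : 2 * theta Y
             = - (kappa * Y) + 2 * (e * (w * theta (theta p)))).
{ unfold Y; rewrite !theta_mul, He.
  transitivity (- (2 * (kappa * e * (w * theta p)))
                + e * ((2 * theta w) * theta p)
                + 2 * (e * (w * theta (theta p)))); [ring|].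
  rewrite Hw; ring. }
assert (HeX : theta e * (w * p) = - (kappa * X)).
{ rewrite He; unfold X; ring. }
assert (H2 : 2 * theta (theta X) = theta (- (kappa * X)) + 2 * theta Y).
{ transitivity (theta (2 * theta X)).
  - rewrite theta_mul, theta_add, theta_one; ring.
  - rewrite HX, theta_add, (theta_mul 2), theta_add, theta_one; ring. }
rewrite HeX, H2.
transitivity (2 * (2 * (2 * (2 * theta Y)))); [ring|].
rewrite HY.
transitivity (- (2 * (2 * (2 * (kappa * Y))))
  + e * w * (2 * (2 * (2 * (2 * theta (theta p)))))); [ring|].
rewrite Hp; unfold X, Y; ring.
Qed.

(** The formal version of [sin^2 + cos^2 = 1]: [e * zeta] is [sin^2 (y/2)] and
[e * (1 - kappa)^2] is [cos^2 (y/2)]. *)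
Lemma riccati_first_integral (kappa e : fps) :
  2 * theta kappa = zeta + kappa * kappa - kappa ->
  theta e = - (kappa * e) ->
  theta (e * ((1 - kappa) * (1 - kappa) + zeta)) = 0.
Proof.
intros Hk He.
rewrite theta_mul, theta_add, theta_mul, theta_sub, theta_one, theta_zeta, He.
transitivity (e * (- kappa * ((1 - kappa) * (1 - kappa) + zeta)
   - (1 - kappa) * (2 * theta kappa) + zeta)); [ring|].
rewrite Hk; ring.
Qed.

(** The equation [f'' = 2 - f] of [f = 2 - 2 cos y], written for [e = f / y^2]; being
linear, it gives the coefficients of [e] in closed form. *)
Lemma riccati_linear (kappa e : fps) :
  2 * theta kappa = zeta + kappa * kappa - kappa ->
  theta e = - (kappa * e) ->
  e * ((1 - kappa) * (1 - kappa) + zeta) = 1 ->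
  2 * theta (theta e) + (2 * theta e + theta e) + e
    = 1 - 2 * (zeta * e).
Proof.
intros Hk He H1.
assert (H2 : 2 * theta (theta e)
  = e * (2 * (kappa * kappa) - (zeta + kappa * kappa - kappa))).
{ rewrite He; rewrite <- Hk.
  transitivity (2 * theta (0 - kappa * e)).
  { f_equal; f_equal; ring. }
  rewrite theta_sub, theta_mul, He.
  replace (theta 0) with 0; [ring|].
  apply functional_extensionality; intros n; unfold theta, fzero.
  now rewrite Rmult_0_r. }
rewrite H2, He.
transitivity (e * ((1 - kappa) * (1 - kappa) + zeta) - 2 * (zeta * e));
  [ring|].
now rewrite H1.
Qed.
End Legendre.

Lemma two_mul (f : fps) (n : nat) : fmul (fadd fone fone) f n = 2 * f n.
Proof. rewrite fmul_addl, fmul_onel; ring. Qed.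

Lemma fadd_coef (f g : fps) (n : nat) : fadd f g n = f n + g n.
Proof. reflexivity. Qed.

Lemma fsub_coef (f g : fps) (n : nat) : fsub f g n = f n - g n.
Proof. reflexivity. Qed.

Definition times_z (h : fps) : fps := (2 * (2 * (zeta * h)))%fps.

Lemma times_z_mul (h f : fps) (n : nat) :
  fmul (times_z h) f n = match n with O => 0 | S m => fmul h f m end.
Proof.
unfold times_z.
replace (fmul _ f) with (2 * (2 * (zeta * (h * f))))%fps by ring.
rewrite !two_mul, zeta_mul; destruct n; lra.
Qed.

Lemma times_z_riccati (h : fps) :
  cot_recurrence h ->
  (2 * theta (times_z h) = zeta + times_z h * times_z h - times_z h)%fps.
Proof.
intros Hh.
assert (H : (2 * (2 * (2 * theta h)) =
   1 + 2 * (2 * (2 * (2 * (zeta * (h * h))))) - 2 * (2 * (2 * h + h)))%fps).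
{ apply functional_extensionality; intros n.
  rewrite fsub_coef, !fadd_coef, !two_mul, fadd_coef, two_mul, zeta_mul.
  specialize (Hh n); unfold theta; destruct n; lra. }
unfold times_z; rewrite !theta_mul, !theta_add, theta_one, theta_zeta.
transitivity (zeta * (2 * (2 * (2 * theta h))) + 2 * (2 * (2 * (zeta * h))))%fps;
  [ring|].
rewrite H; ring.
Qed.

Lemma sin_sq_series_explicit (h e : fps) :
  (2 * theta (times_z h) = zeta + times_z h * times_z h - times_z h)%fps ->
  theta e = (- (times_z h * e))%fps -> e O = 1 ->
  forall n, e n = 2 * (-1) ^ n / INR (fact (2 * n + 2)).
Proof.
intros Hk He He0.
(* The first integral is constant, with value [e 0 = 1]. *)
assert (H1 : (e * ((1 - times_z h) * (1 - times_z h) + zeta) = 1)%fps).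
{ apply functional_extensionality; intros [|n].
  - assert (Hl : times_z h O = 0).
    { unfold times_z; rewrite !two_mul, zeta_mul; ring. }
    simpl; unfold fadd, fsub; simpl; rewrite Hl, He0; ring.
  - apply (theta_eq_0 _ (riccati_first_integral _ _ Hk He) n). }
pose proof (riccati_linear _ _ Hk He H1) as HL.
induction n as [|n IH].
- rewrite He0; simpl; lra.
- apply (f_equal (fun f => f (S n))) in HL.
  rewrite fsub_coef, !fadd_coef, !two_mul, zeta_mul in HL.
  unfold theta in HL; rewrite IH in HL.
  simpl fone in HL.
  replace (2 * S n + 2)%nat with (S (S (2 * n + 2))) by lia.
  rewrite !fact_simpl, !mult_INR.
  pose proof (INR_fact_neq_0 (2 * n + 2)).
  pose proof (pos_INR n).
  assert (E1 : INR (S (2 * n + 2)) = 2 * INR n + 3).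
  { rewrite S_INR, plus_INR, mult_INR; simpl; ring. }
  rewrite (S_INR (S (2 * n + 2))), E1.
  rewrite S_INR in HL.
  apply (Rmult_eq_reg_l ((2 * INR n + 4) * (INR n + 3 / 2))); [|nra].
  transitivity (- (2 * (/ 4 * (2 * (-1) ^ n / INR (fact (2 * n + 2)))))).
  + set (v := 2 * (-1) ^ n / INR (fact (2 * n + 2))) in *; lra.
  + change ((-1) ^ S n) with (-1 * (-1) ^ n); field; repeat split; lra.
Qed.

Lemma sin_sq_series_derivative (h e : fps) :
  (forall n, INR (S n) * e (S n) = - fmul h e n) ->
  theta e = (- (times_z h * e))%fps.
Proof.
intros He; apply functional_extensionality; intros [|n];
  unfold fopp, theta; rewrite times_z_mul; [simpl; ring|apply He].
Qed.

Lemma cot_series_head (h : fps) :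
  cot_recurrence h ->
  h 0%nat = / 12 /\ h 1%nat = / 720 /\ h 2%nat = / 30240.
Proof.
intros Hh.
pose proof (Hh 0%nat) as H0; pose proof (Hh 1%nat) as H1;
  pose proof (Hh 2%nat) as H2; simpl in H0, H1, H2; unfold ftail in H2.
assert (E0 : h 0%nat = / 12) by lra; rewrite E0 in *.
assert (E1 : h 1%nat = / 720) by lra; rewrite E1 in *.
repeat split; lra.
Qed.

Lemma cot_series_pos (h : fps) :
  cot_recurrence h ->
  forall n, 0 < h n.
Proof.
intros Hh n; induction n as [[|n] IH] using lt_wf_ind.
- destruct (cot_series_head h Hh) as [-> _]; lra.
- assert (0 < fmul h h n) by (apply fmul_pos; intros; apply IH; lia).
  assert (E : (8 * INR (S n) + 12) * h (S n) = 4 * fmul h h n)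
    by (rewrite Hh; apply Rplus_0_l).
  pose proof (pos_INR (S n)).
  apply (Rmult_lt_reg_l (8 * INR (S n) + 12)); lra.
Qed.

(** Isolates the first two coefficients of [h], for which the ratio [h 1 / h 0] may be
smaller than [c]. *)
Lemma fmul_tail2_ge (h g : fps) (c : R) (n : nat) :
  (forall k, (k <= n)%nat -> c * h (S k) <= h (S (S k))) ->
  (forall k, (k <= n)%nat -> 0 <= g k) ->
  fmul h g (S (S n)) >=
    h 0%nat * g (S (S n)) + h 1%nat * g (S n)
    + c * (fmul h g (S n) - h 0%nat * g (S n)).
Proof.
intros Hc Hg.
pose proof (fmul_le (fun k => c * ftail h k) (ftail (ftail h)) g n Hc Hg) as H.
rewrite fmul_scall in H.
change (fmul h g (S (S n))) with
  (h 0%nat * g (S (S n)) + (h 1%nat * g (S n) + fmul (ftail (ftail h)) g n)).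
change (fmul h g (S n)) with (h 0%nat * g (S n) + fmul (ftail h) g n).
lra.
Qed.

(** The ratios tend to [1/(4 PI^2)], which is above 1/40; the first ratio is only
1/60 and is left out.  In the induction the deficit of that first ratio is paid
for by the term of [h 0 = 1/12]. *)
Lemma cot_series_ratio (h : fps) :
  cot_recurrence h ->
  forall n, / 48 * h (S n) <= h (S (S n)).
Proof.
intros Hh n; destruct (cot_series_head h Hh) as [E0 [E1 E2]].
pose proof (cot_series_pos h Hh) as Hpos.
induction n as [[|n] IH] using lt_wf_ind.
- rewrite E1, E2; lra.
- pose proof (fmul_tail2_ge h h (/ 48) n) as H.
  specialize (H (fun k Hk => IH k ltac:(lia))
                (fun k _ => Rlt_le _ _ (Hpos k))).
  rewrite E0, E1 in H.
  assert (E : forall m, (8 * INR (S m) + 12) * h (S m) = 4 * fmul h h m)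
    by (intros m; rewrite Hh; apply Rplus_0_l).
  pose proof (E (S n)) as A; pose proof (E (S (S n))) as B.
  rewrite !S_INR in A; rewrite !S_INR in B.
  specialize (IH n ltac:(lia)).
  pose proof (Hpos (S n)); pose proof (Hpos (S (S n)));
  pose proof (pos_INR n).
  apply (Rmult_le_reg_l (8 * (INR n + 1 + 1 + 1) + 12)); lra.
Qed.

Lemma csc_series_pos (h w : fps) :
  (forall n, 0 < h n) -> w O = 1 ->
  (forall n, 2 * INR (S n) * w (S n) = fmul h w n) ->
  forall n, 0 < w n.
Proof.
intros Hpos H0 Hw n; induction n as [[|n] IH] using lt_wf_ind.
- rewrite H0; lra.
- assert (0 < fmul h w n) by (apply fmul_pos; intros; auto; apply IH; lia).
  specialize (Hw n); pose proof (lt_0_INR (S n) ltac:(lia)).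
  apply (Rmult_lt_reg_l (2 * INR (S n))); lra.
Qed.

Lemma csc_series_ratio (h w : fps) :
  cot_recurrence h ->
  w O = 1 -> (forall n, 2 * INR (S n) * w (S n) = fmul h w n) ->
  forall n, / 48 * w n <= w (S n).
Proof.
intros Hh H0 Hw n; destruct (cot_series_head h Hh) as [E0 [E1 E2]].
pose proof (csc_series_pos h w (cot_series_pos h Hh) H0 Hw) as Hpos.
pose proof (Hw 0%nat) as W1; pose proof (Hw 1%nat) as W2.
simpl in W1, W2; unfold ftail in W2.
rewrite E0, ?E1, H0 in W1, W2.
induction n as [[|[|n]] IH] using lt_wf_ind.
- lra.
- lra.
- pose proof (fmul_tail2_ge h w (/ 48) n) as H.
  specialize (H (fun k Hk => cot_series_ratio h Hh k)
                (fun k _ => Rlt_le _ _ (Hpos k))).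
  rewrite E0, E1 in H.
  pose proof (Hw (S n)) as A; pose proof (Hw (S (S n))) as B.
  rewrite !S_INR in A; rewrite !S_INR in B.
  specialize (IH (S n) ltac:(lia)).
  pose proof (Hpos (S n)); pose proof (Hpos (S (S n)));
  pose proof (pos_INR n).
  apply (Rmult_le_reg_l (2 * (INR n + 1 + 1 + 1))); lra.
Qed.

Lemma legendre_series_pos (h p : fps) :
  (forall n, 0 < h n) -> p O = 1 ->
  (forall n, 16 * INR (S n) ^ 2 * p (S n) = 8 * fmul h (theta p) n + p n / 4) ->
  forall n, 0 < p n.
Proof.
intros Hpos H0 Hp n; induction n as [[|n] IH] using lt_wf_ind.
- rewrite H0; lra.
- assert (0 <= fmul h (theta p) n).
  { replace 0 with (fmul (fun k => 0 * h k) (theta p) n)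
      by (rewrite fmul_scall; ring).
    apply fmul_le; intros k Hk; [specialize (Hpos k); lra|].
    unfold theta; specialize (IH k ltac:(lia)); pose proof (pos_INR k).
    apply Rmult_le_pos; lra. }
  specialize (Hp n); specialize (IH n ltac:(lia)).
  assert (0 < INR (S n) ^ 2) by (apply pow_lt, lt_0_INR; lia).
  apply (Rmult_lt_reg_l (16 * INR (S n) ^ 2)); lra.
Qed.

(** The coefficient [d (n - i) (n + 1)], up to factorials that depend on [n] alone or
on [n - i] alone; in this form the case [j = 0] of [d] is no exception. *)
Definition weight (n i : nat) : R :=
  2 * INR n * (4 * INR n - 2 * INR i) / INR (fact (2 * i + 2))
  + match i with O => 0 | S _ => / (8 * INR (fact (2 * i))) end.

Lemma pow_m1_sq (n : nat) : (-1) ^ n * (-1) ^ n = 1.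
Proof.
rewrite <- Rpow_mult_distr; replace (-1 * -1) with 1 by ring; apply pow1.
Qed.

Lemma pow_m1_sub (n j : nat) : (j <= n)%nat ->
  (-1) ^ (n - j) = (-1) ^ n * (-1) ^ j.
Proof.
intros H; replace n with ((n - j) + j)%nat at 2 by lia.
rewrite pow_add, Rmult_assoc, pow_m1_sq; ring.
Qed.

Lemma sum_scal (c : R) (f : nat -> R) (a b : nat) :
  sum_n_m (fun k => c * f k) a b = c * sum_n_m f a b.
Proof. exact (sum_n_m_mult_l (K := R_Ring) c f a b). Qed.

(** The witness is the product [w * p]: the growth bound passes from [w] to the
product because [p] is positive. *)
Lemma legendre_coefficients : exists B : nat -> R,
  B O = 1 /\ (forall n, 0 < B n) /\ (forall n, / 48 * B n < B (S n)) /\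
  forall n,
    sum_n_m (fun j => (-1) ^ j * (weight n (n - j) * B j)) 0 n = 0.
Proof.
destruct cot_series_exists as [h Hh].
destruct (csc_series_exists h) as [w [Hw0 Hw]].
destruct (sin_sq_series_exists h) as [e [He0 He]].
destruct (legendre_series_exists h) as [p [Hp0 Hp]].
pose proof (cot_series_pos h Hh) as Ph.
pose proof (csc_series_pos h w Ph Hw0 Hw) as Pw.
pose proof (legendre_series_pos h p Ph Hp0 Hp) as Pp.
exists (fmul w p); split; [simpl; rewrite Hw0, Hp0; ring|].
split; [intros n; apply fmul_pos; auto|].
split.
{ intros n; simpl fmul.
  pose proof (fmul_le (fun k => / 48 * w k) (ftail w) p n
    (fun k _ => csc_series_ratio h w Hh Hw0 Hw k)
    (fun k _ => Rlt_le _ _ (Pp k))) as H.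
  rewrite fmul_scall in H; rewrite Hw0; specialize (Pp (S n)); lra. }
pose proof (times_z_riccati h Hh) as Hk.
pose proof (sin_sq_series_derivative h e He) as HE.
pose proof (sin_sq_series_explicit h e Hk HE He0) as Hexp.
assert (HW : (2 * theta w = times_z h * w)%fps).
{ apply functional_extensionality; intros n.
  rewrite two_mul, times_z_mul; unfold theta; destruct n; [simpl; ring|].
  rewrite <- Hw; ring. }
assert (HP : (2 * (2 * (2 * (2 * theta (theta p))))
    = 2 * (2 * (2 * (times_z h * theta p))) + zeta * p)%fps).
{ apply functional_extensionality; intros n.
  rewrite fadd_coef, !two_mul, times_z_mul, zeta_mul.
  unfold theta at 1 2; destruct n; [simpl; ring|].
  specialize (Hp n); lra. }
pose proof (legendre_identity (times_z h) e w p HE HW HP) as HL.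
intros n.
set (B := fmul w p) in *.
set (N := INR n).
(* [E i] is [4 (-1)^i * weight n i], by the closed form of [e]. *)
set (E := fadd (fun k => 16 * N ^ 2 * e k)
  (fadd (fun k => - (8 * N) * theta e k) (fun k => - 1 * fmul zeta e k))).
transitivity ((-1) ^ n / 4 * fmul B E n).
- rewrite fmul_sum.
  rewrite <- sum_scal.
  apply sum_n_m_ext_loc; intros j Hj.
  real_eq.
  assert (Hs := pow_m1_sub n j (proj2 Hj)).
  replace ((-1) ^ j) with ((-1) ^ n * (-1) ^ (n - j))
    by (rewrite Hs, <- Rmult_assoc, pow_m1_sq; ring).
  unfold E; rewrite !fadd_coef, zeta_mul.
  unfold theta; rewrite Hexp.
  unfold weight; fold N; set (i := (n - j)%nat).
  destruct i as [|i].
  + simpl; field.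
  + rewrite (Hexp i).
    replace (2 * S i)%nat with (2 * i + 2)%nat by lia.
    change ((-1) ^ S i) with (-1 * (-1) ^ i).
    field; split; apply INR_fact_neq_0.
- unfold E; rewrite (fmul_comm B), !fmul_addl, !fmul_scall.
  apply (f_equal (fun f => f n)) in HL.
  rewrite fsub_coef, !two_mul in HL.
  unfold theta at 1 2 3 in HL; fold N in HL.
  replace (zeta * (e * B))%fps with (zeta * e * B)%fps in HL by ring.
  match goal with |- _ * ?x = 0 => replace x with 0; [apply Rmult_0_r|] end.
  lra.
Qed.

(** * Signs of the residual coefficients *)

Lemma weight_pos (n i : nat) : (1 <= n)%nat -> (i <= n)%nat -> 0 < weight n i.
Proof.
intros Hn Hi; unfold weight.
apply le_INR in Hn, Hi; simpl in Hn.
apply Rplus_lt_le_0_compat.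
- apply Rdiv_lt_0_compat; [|apply INR_fact_lt_0].
  apply Rmult_lt_0_compat; lra.
- destruct i; [lra|].
  pose proof (INR_fact_lt_0 (2 * S i)).
  left; apply Rinv_0_lt_compat; lra.
Qed.

(** The first summands have a quotient of at least [(2i+4)(2i+3) >= 56]; the others,
whose quotient may be as small as 30, are a small part of the weight. *)
Lemma weight_growth (n i : nat) : (2 <= i)%nat -> (S i <= n)%nat ->
  48 * weight n (S i) <= weight n i.
Proof.
intros Hi Hn; unfold weight; destruct i as [|i]; [lia|].
replace (2 * S (S i) + 2)%nat with (S (S (S (S (2 * S i))))) by lia.
replace (2 * S i + 2)%nat with (S (S (2 * S i))) by lia.
replace (2 * S (S i))%nat with (S (S (2 * S i))) by lia.
apply le_INR in Hi, Hn; rewrite S_INR in Hn.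
rewrite !fact_simpl, !mult_INR.
pose proof (INR_fact_lt_0 (2 * S i)) as HF.
rewrite (S_INR (S (S (S (2 * S i))))), (S_INR (S (S (2 * S i)))),
  (S_INR (S (2 * S i))), (S_INR (2 * S i)), mult_INR, (S_INR (S i)).
set (F := INR (fact (2 * S i))) in *.
set (x := INR (S i)) in *; set (y := INR n) in *.
change (INR 2) with 2 in *.
set (P := (2 * x + 1 + 1 + 1 + 1) * (2 * x + 1 + 1 + 1)).
set (Q := (2 * x + 1 + 1) * (2 * x + 1)).
assert (HP : 56 <= P) by (unfold P; nra).
assert (HQ : 30 <= Q) by (unfold Q; nra).
apply Rminus_le_0.
replace (_ - _) with
  ((16 * y * (4 * y - 2 * x) * P + P * Q
    - 48 * (16 * y * (4 * y - 2 * (x + 1)) + P)) / (8 * P * Q * F))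
  by (unfold P, Q; field; repeat split; lra).
apply Rdiv_le_0_compat; [|repeat apply Rmult_lt_0_compat; lra].
assert (H1 : 384 <= 16 * y * (4 * y - 2 * x)).
{ assert (48 * 8 <= (16 * y) * (4 * y - 2 * x))
    by (apply Rmult_le_compat; lra); lra. }
assert (H2 : 384 * (P - 48) <= 16 * y * (4 * y - 2 * x) * (P - 48))
  by (apply Rmult_le_compat_r; lra).
assert (H3 : P * 30 <= P * Q) by (apply Rmult_le_compat_l; lra).
lra.
Qed.

(** The upper bound is what makes the induction go through: adding a larger term of
the opposite sign reverses the sign of the sum. *)
Lemma alternating_sum_bounds (a : nat -> R) (k : nat) :
  0 < a O -> (forall j, (S j <= k)%nat -> a j < a (S j)) ->
  0 < (-1) ^ k * sum_n_m (fun j => (-1) ^ j * a j) 0 k <= a k.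
Proof.
intros H0; induction k as [|k IH]; intros Ha.
- rewrite sum_n_n; simpl; lra.
- destruct IH as [IH1 IH2]; [intros j Hj; apply Ha; lia|].
  rewrite sum_n_Sm by lia.
  change plus with Rplus.
  specialize (Ha k ltac:(lia)).
  rewrite Rmult_plus_distr_l, <- Rmult_assoc, pow_m1_sq.
  change ((-1) ^ S k) with (-1 * (-1) ^ k).
  lra.
Qed.

Lemma d_weight (n j : nat) : (1 <= j)%nat -> (j <= n)%nat ->
  d j (n + 1) = weight n (n - j) * INR (fact (2 * n - 1))
                / INR (fact (2 * j - 1)).
Proof.
intros Hj Hn; unfold d, weight.
rewrite (proj2 (Nat.eqb_neq j 0)) by lia.
destruct (Nat.eqb_spec (n + 1) (j + 1)) as [E|E].
- replace j with n by lia; rewrite Nat.sub_diag.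
  simpl fact; simpl INR; field.
  apply INR_fact_neq_0.
- replace (2 * (n + 1) - 2)%nat with (S (2 * n - 1)) by lia.
  replace (2 * (n + 1) - 2 * j)%nat with (2 * (n - j) + 2)%nat by lia.
  replace (2 * (n + 1) - 2 * j - 2)%nat with (2 * (n - j))%nat by lia.
  replace (2 * (n + 1) - 3)%nat with (2 * n - 1)%nat by lia.
  replace (2 * (n - j) + 2 - 2)%nat with (2 * (n - j))%nat by lia.
  rewrite fact_simpl, mult_INR.
  replace (S (2 * n - 1)) with (2 * n)%nat by lia.
  rewrite plus_INR, mult_INR, (minus_INR n j) by lia.
  destruct (n - j)%nat eqn:Enj; [lia|].
  simpl (INR 2); simpl (INR 1).
  field; repeat split; apply INR_fact_neq_0.
Qed.

Lemma d0_weight (n : nat) : (1 <= n)%nat ->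
  d 0 (n + 1) = weight n n * INR (fact (2 * n - 1)).
Proof.
intros Hn; unfold d, weight; simpl (0 =? 0)%nat; cbv iota.
assert (E1 : INR (fact (2 * n)) = 2 * INR n * INR (fact (2 * n - 1))).
{ replace (2 * n)%nat with (S (2 * n - 1)) at 1 by lia.
  rewrite fact_simpl, mult_INR.
  replace (S (2 * n - 1)) with (2 * n)%nat by lia.
  rewrite mult_INR; reflexivity. }
assert (E2 : INR (fact (2 * n + 2))
  = (2 * INR n + 2) * ((2 * INR n + 1) * INR (fact (2 * n)))).
{ replace (2 * n + 2)%nat with (S (S (2 * n))) by lia.
  rewrite !fact_simpl, !mult_INR, !S_INR, mult_INR; simpl (INR 2); ring. }
rewrite E2, E1, plus_INR; simpl (INR 1).
pose proof (lt_0_INR n Hn).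
pose proof (INR_fact_neq_0 (2 * n - 1)).
destruct n as [|n]; [lia|].
field; repeat split; lra.
Qed.

(** Both sides satisfy the same recursion, since the term [j = k] of the hypothesis
has weight [4 k^2]. *)
Lemma beta2_closed (B : nat -> R) :
  B O = 1 ->
  (forall n, sum_n_m (fun j => (-1) ^ j * (weight n (n - j) * B j)) 0 n = 0) ->
  forall k, (1 <= k)%nat ->
    beta2 k = - (-1) ^ k * (INR (fact (2 * k - 1)) * B k).
Proof.
intros B0 HB k; induction k as [k IH] using lt_wf_ind; intros Hk.
rewrite beta2_rec by exact Hk.
rewrite (sum_n_m_ext_loc _ (fun j => - INR (fact (2 * k - 1)) *
  ((-1) ^ j * (weight k (k - j) * B j)))).
2:{ intros j Hj; rewrite IH, d_weight by lia.
    real_eq.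
    field; apply INR_fact_neq_0. }
rewrite sum_scal, d0_weight by exact Hk.
specialize (HB k).
rewrite sum_Sn_m in HB by lia.
destruct k as [|k]; [lia|].
rewrite sum_n_Sm in HB by lia.
replace (S k - 1)%nat with k by lia.
rewrite Nat.sub_diag, Nat.sub_0_r, B0 in HB.
change plus with Rplus in HB.
set (s := sum_n_m _ 1 k) in *.
replace (weight (S k) 0) with (4 * INR (S k) ^ 2) in HB
  by (unfold weight; simpl fact; simpl (INR 0); simpl (INR 2); field).
replace s with (- weight (S k) (S k)
   - (-1) ^ S k * (4 * INR (S k) ^ 2 * B (S k))) by (simpl pow in *; lra).
field; apply not_0_INR; lia.
Qed.

Lemma residual_vanishes (n : nat) : (1 <= n)%nat ->
  sum_n_m (fun j => d j (n + 1) * beta2 j) 1 n - d 0 (n + 1) = 0.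
Proof.
intros Hn; destruct n as [|n]; [lia|].
rewrite sum_n_Sm by lia.
rewrite (beta2_rec (S n) Hn).
replace (S n - 1)%nat with n by lia.
replace (d (S n) (S n + 1)) with (4 * INR (S n) ^ 2)
  by (unfold d; rewrite Nat.eqb_refl; reflexivity).
change plus with Rplus; field; apply not_0_INR; lia.
Qed.

(** The terms increase in absolute value up to index [n - 2], so a partial sum that
stops there or earlier has the sign of its last term; the sum up to [n - 1] is minus
the last term of a complete sum that is zero. *)
Lemma residual_sign (l n : nat) : (1 <= l <= n)%nat ->
  0 < (-1) ^ l *
    (sum_n_m (fun j => d j (n + 1) * beta2 j) 1 (l - 1) - d 0 (n + 1)).
Proof.
intros Hln.
destruct legendre_coefficients as [B [B0 [Bpos [Brat HB]]]].
pose proof (beta2_closed B B0 HB) as Hbeta.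
set (a := fun j => weight n (n - j) * B j).
assert (Hsum : forall m, (m <= n)%nat ->
  sum_n_m (fun j => d j (n + 1) * beta2 j) 1 m - d 0 (n + 1)
  = - INR (fact (2 * n - 1)) * sum_n_m (fun j => (-1) ^ j * a j) 0 m).
{ intros m Hm; rewrite (sum_Sn_m _ 0 m) by lia.
  rewrite (sum_n_m_ext_loc _ (fun j => - INR (fact (2 * n - 1)) *
    ((-1) ^ j * a j))).
  2:{ intros j Hj; rewrite Hbeta, d_weight by lia; unfold a.
      real_eq.
      field; apply INR_fact_neq_0. }
  rewrite sum_scal, d0_weight by lia.
  unfold a at 2; rewrite Nat.sub_0_r, B0.
  change plus with Rplus; simpl pow; ring. }
rewrite Hsum by lia.
pose proof (INR_fact_lt_0 (2 * n - 1)) as HF.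
assert (Hpos : 0 < (-1) ^ (l - 1) * sum_n_m (fun j => (-1) ^ j * a j) 0 (l - 1)).
{ destruct (Nat.eq_dec l n) as [->|Hne].
  - assert (HB' : sum_n_m (fun j => (-1) ^ j * a j) 0 n = 0) by exact (HB n).
    clear HB; rename HB' into HB; destruct n as [|n]; [lia|].
    rewrite sum_n_Sm in HB by lia.
    replace (S n - 1)%nat with n by lia.
    change plus with Rplus in HB.
    assert (Ha : 0 < a (S n)).
    { unfold a; apply Rmult_lt_0_compat; [apply weight_pos; lia|apply Bpos]. }
    replace (sum_n_m (fun j => (-1) ^ j * a j) 0 n) with ((-1) ^ n * a (S n)).
    + rewrite <- Rmult_assoc, pow_m1_sq; lra.
    + change ((-1) ^ S n) with (-1 * (-1) ^ n) in HB; lra.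
  - apply alternating_sum_bounds.
    + unfold a; apply Rmult_lt_0_compat; [apply weight_pos; lia|apply Bpos].
    + intros j Hj; unfold a.
      pose proof (weight_growth n (n - S j) ltac:(lia) ltac:(lia)) as Hw.
      replace (S (n - S j)) with (n - j)%nat in Hw by lia.
      pose proof (weight_pos n (n - j) ltac:(lia) ltac:(lia)).
      pose proof (Brat j); pose proof (Bpos (S j)); pose proof (Bpos j).
      apply Rlt_le_trans with (48 * weight n (n - j) * B (S j)).
      * replace (48 * weight n (n - j) * B (S j))
          with (weight n (n - j) * (48 * B (S j))) by ring.
        apply Rmult_lt_compat_l; lra.
      * apply Rmult_le_compat_r; lra. }
replace ((-1) ^ l) with (-1 * (-1) ^ (l - 1))
  by (destruct l; [lia|]; simpl; rewrite Nat.sub_0_r; reflexivity).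
nra.
Qed.

(** * Binomial and logarithmic series *)

Lemma is_series_even (u : nat -> R) (l : R) :
  (forall k, u (2 * k + 1)%nat = 0) -> is_series u l ->
  is_series (fun k => u (2 * k)%nat) l.
Proof.
intros Hu Hs.
change (is_lim_seq (sum_n (fun k => u (2 * k)%nat)) (Finite l)).
apply (is_lim_seq_ext (fun n => sum_n u (2 * n))).
- induction n as [|n IH]; [rewrite !sum_O; reflexivity|].
  replace (2 * S n)%nat with (S (S (2 * n))) by lia.
  rewrite !sum_Sn, IH.
  replace (u (S (2 * n))) with 0
    by (rewrite <- (Hu n); f_equal; lia).
  replace (2 * S n)%nat with (S (S (2 * n))) by lia.
  change plus with Rplus; ring.
- apply (is_lim_seq_subseq (sum_n u) l (fun n => (2 * n)%nat)); [|exact Hs].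
  apply eventually_subseq; intros; lia.
Qed.

Lemma is_series_odd (u : nat -> R) (l : R) :
  (forall k, u (2 * k)%nat = 0) -> is_series u l ->
  is_series (fun k => u (2 * k + 1)%nat) l.
Proof.
intros Hu Hs.
assert (H1 : is_series (fun k => u (S k)) l).
{ apply is_series_incr_1; rewrite (Hu 0%nat : u 0%nat = 0).
  change plus with Rplus; now rewrite Rplus_0_r. }
apply (is_series_ext (fun k => u (S (2 * k)))).
- intros k; f_equal; lia.
- apply (is_series_even (fun k => u (S k))); [|exact H1].
  intros k; rewrite <- (Hu (S k)); f_equal; lia.
Qed.

(** For [N = 1/t], expands [(N^2 + 1/16) (F + G - 2 c_0) - (N/2) (F - G)], which is
[diff_op] at [N] of a function whose values at [N - 1], [N] and [N + 1] are those of
[sum c_i x^i] at [t], [0] and [-t].  Only even powers of [t] survive. *)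
Lemma even_operator_series (c : nat -> R) (t F G : R) :
  0 < t -> is_series (fun i => c i * t ^ i) F ->
  is_series (fun i => c i * (- t) ^ i) G ->
  is_series (fun m => (2 * c (2 * m + 2)%nat - c (2 * m + 1)%nat
      + match m with O => 0 | S _ => c (2 * m)%nat / 8 end) * t ^ (2 * m))
    ((/ t ^ 2 + / 16) * (F + G - 2 * c 0%nat) - / (2 * t) * (F - G)).
Proof.
intros Ht HF HG.
assert (Hev : is_series (fun m => 2 * c (2 * m)%nat * t ^ (2 * m)) (F + G)).
{ apply (is_series_ext (fun m => c (2 * m)%nat * t ^ (2 * m)
     + c (2 * m)%nat * (- t) ^ (2 * m))).
  - intros m; rewrite (pow_mult (- t)), (pow_mult t).
    replace ((- t) ^ 2) with (t ^ 2) by ring.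
    real_eq; ring.
  - apply (is_series_even (fun i => c i * t ^ i + c i * (- t) ^ i)).
    + intros k; rewrite !pow_add, (pow_mult (- t)), (pow_mult t).
      replace ((- t) ^ 2) with (t ^ 2) by ring; ring.
    + apply (is_series_plus _ _ _ _ HF HG). }
assert (Hod : is_series (fun m => 2 * c (2 * m + 1)%nat * t ^ (2 * m + 1))
   (F - G)).
{ apply (is_series_ext (fun m => c (2 * m + 1)%nat * t ^ (2 * m + 1)
     + - (c (2 * m + 1)%nat * (- t) ^ (2 * m + 1)))).
  - intros m; rewrite !pow_add, (pow_mult (- t)), (pow_mult t).
    replace ((- t) ^ 2) with (t ^ 2) by ring.
    real_eq; ring.
  - apply (is_series_odd (fun i => c i * t ^ i + - (c i * (- t) ^ i))).
    + intros k; rewrite (pow_mult (- t)), (pow_mult t).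
      replace ((- t) ^ 2) with (t ^ 2) by ring; ring.
    + apply (is_series_minus _ _ _ _ HF HG). }
assert (Hev1 : is_series (fun m => 2 * c (2 * S m)%nat * t ^ (2 * S m))
   (F + G - 2 * c 0%nat)).
{ apply (is_series_incr_1 (fun m => 2 * c (2 * m)%nat * t ^ (2 * m))).
  change plus with Rplus; simpl pow; simpl Nat.mul.
  replace (F + G - 2 * c 0%nat + 2 * c 0%nat * 1) with (F + G) by ring.
  exact Hev. }
assert (Hev0 : is_series (fun m => match m with O => 0
    | S _ => 2 * c (2 * m)%nat * t ^ (2 * m) end) (F + G - 2 * c 0%nat)).
{ apply is_series_decr_1.
  change plus with Rplus; change opp with Ropp.
  rewrite Ropp_0, Rplus_0_r; exact Hev1. }
pose proof (is_series_plus _ _ _ _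
  (is_series_plus _ _ _ _ (is_series_scal (/ t ^ 2) _ _ Hev1)
    (is_series_scal (/ 16) _ _ Hev0))
  (is_series_scal (- / (2 * t)) _ _ Hod)) as H.
replace (_ - _) with
 (plus (plus (scal (/ t ^ 2) (F + G - 2 * c 0%nat))
    (scal (/ 16) (F + G - 2 * c 0%nat))) (scal (- / (2 * t)) (F - G))).
2:{ change plus with Rplus; change scal with Rmult; real_eq; ring. }
revert H; apply is_series_ext; intros m.
change plus with Rplus; change scal with Rmult.
replace (2 * S m)%nat with (2 * m + 2)%nat by lia.
rewrite !pow_add.
real_eq.
destruct m as [|m]; simpl pow; field; lra.
Qed.

(** The coefficients of [(1 - t)^(-(p+1))]. *)
Definition bin (p i : nat) : R :=
  INR (fact (p + i)) / (INR (fact p) * INR (fact i)).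

Lemma bin_0 (i : nat) : bin 0 i = 1.
Proof. unfold bin; simpl; field; apply INR_fact_neq_0. Qed.

Lemma bin_derive (p i : nat) :
  PS_derive (bin p) i = INR (S p) * bin (S p) i.
Proof.
unfold PS_derive, bin.
replace (p + S i)%nat with (S p + i)%nat by lia.
rewrite (fact_simpl i), (fact_simpl p), !mult_INR.
pose proof (not_0_INR (S i) ltac:(lia)); pose proof (not_0_INR (S p) ltac:(lia)).
pose proof (INR_fact_neq_0 i); pose proof (INR_fact_neq_0 p).
field; repeat split; assumption.
Qed.

Lemma bin_radius (p : nat) : CV_radius (bin p) = Finite 1.
Proof.
induction p as [|p IH].
- replace (Finite 1) with (Finite (/ 1)) by (f_equal; field).
  apply CV_radius_finite_DAlembert; [|lra|].
  + intros n; rewrite bin_0; lra.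
  + apply (is_lim_seq_ext (fun _ => 1)); [|apply is_lim_seq_const].
    intros n; rewrite !bin_0, Rdiv_1_r, Rabs_R1; reflexivity.
- rewrite <- IH, <- (CV_radius_derive (bin p)).
  rewrite <- (CV_radius_scal (INR (S p)) (bin (S p)))
    by (apply not_0_INR; lia).
  apply CV_radius_ext; intros n; symmetry; apply bin_derive.
Qed.

Lemma bin_series (p : nat) (t : R) : Rabs t < 1 ->
  is_pseries (bin p) t (/ (1 - t) ^ (S p)).
Proof.
revert t; induction p as [|p IH]; intros t Ht.
- apply is_pseries_R; apply (is_series_ext (fun n => t ^ n)).
  + intros n; rewrite bin_0; symmetry; apply Rmult_1_l.
  + simpl; rewrite Rmult_1_r; apply is_series_geom; exact Ht.
- assert (Hr : Rbar_lt (Rabs t) (CV_radius (bin p)))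
    by (rewrite bin_radius; exact Ht).
  assert (Ht1 : 1 - t <> 0) by (apply Rabs_def2 in Ht; lra).
  pose proof (is_pseries_derive _ _ Hr) as H.
  rewrite (Derive_ext_loc _ (fun x => / (1 - x) ^ (S p))) in H.
  + rewrite (is_derive_unique _ t (INR (S p) / (1 - t) ^ (S (S p)))) in H.
    * pose proof (is_pseries_scal (/ INR (S p)) _ _ _
        (Rmult_comm _ _) H) as H'; clear H; rename H' into H.
      change scal with Rmult in H.
      replace (/ INR (S p) * (INR (S p) / (1 - t) ^ S (S p)))
        with (/ (1 - t) ^ S (S p)) in H
        by (field; split; [apply pow_nonzero; assumption|apply not_0_INR; lia]).
      revert H; apply is_pseries_ext; intros n.
      unfold PS_scal; rewrite bin_derive; change scal with Rmult.
      real_eq; field; apply not_0_INR; lia.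
    * auto_derive; [change ((1 - t) ^ S p <> 0); apply pow_nonzero; assumption|].
      change (pred (S p)) with p; simpl pow.
      change (match p with O => 1 | S _ => INR p + 1 end) with (INR (S p)).
      change (1 + - t) with (1 - t); field; split; [apply pow_nonzero|]; assumption.
  + assert (Hd : 0 < 1 - Rabs t) by lra.
    assert (Hball : forall x : R, Rabs (x - t) < 1 - Rabs t -> Rabs x < 1).
    { intros x Hx; pose proof (Rabs_triang (x - t) t) as H0.
      replace (x - t + t) with x in H0 by ring; lra. }
    exists (mkposreal _ Hd); intros x Hx.
    apply is_pseries_unique, IH, Hball; exact Hx.
Qed.

Lemma log_series (t : R) : Rabs t < 1 ->
  is_pseries (PS_Int (bin 0)) t (- ln (1 - t)).
Proof.
intros Ht.
replace (- ln (1 - t)) with (RInt (PSeries (bin 0)) 0 t).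
- apply is_pseries_RInt; rewrite bin_radius; exact Ht.
- rewrite (RInt_ext _ (fun x => / (1 - x))).
  + apply is_RInt_unique.
    replace (- ln (1 - t)) with (minus (- ln (1 - t)) (- ln (1 - 0))).
    * apply (is_RInt_derive (fun x => - ln (1 - x))).
      -- intros x Hx; auto_derive.
         ++ apply Rabs_def2 in Ht.
            unfold Rmin, Rmax in Hx; destruct (Rle_dec 0 t); lra.
         ++ apply Rabs_def2 in Ht.
            unfold Rmin, Rmax in Hx; destruct (Rle_dec 0 t); field; lra.
      -- intros x Hx; apply (ex_derive_continuous (fun y => / (1 - y))).
         auto_derive; apply Rabs_def2 in Ht.
         unfold Rmin, Rmax in Hx; destruct (Rle_dec 0 t); lra.
    * change minus with Rminus; rewrite Rminus_0_r, ln_1; real_eq; ring.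
  + intros x Hx.
    assert (Hx1 : Rabs x < 1).
    2: rewrite (is_pseries_unique _ _ _ (bin_series 0 x Hx1)), pow_1;
       reflexivity.
    apply Rabs_def2 in Ht; apply Rabs_def1;
    unfold Rmin, Rmax in Hx; destruct (Rle_dec 0 t); lra.
Qed.

(** * The difference operator on the truncated expansion *)

Lemma inv_gt1_bounds (x : R) : 1 < x -> 0 < / x < 1.
Proof.
intros Hx; split; [apply Rinv_0_lt_compat; lra|].
rewrite <- Rinv_1; apply Rinv_lt_contravar; lra.
Qed.

(** The identity [(n+1)^2 a_(n+1) = (n+1/2)^2 a_n] for the increments of [landau] says
that it annihilates [landau n], read as a function of [N = n + 3/4]. *)
Definition diff_op (f : R -> R) (N : R) : R :=
  (N + / 4) ^ 2 * (f (N + 1) - f N) - (N - / 4) ^ 2 * (f N - f (N - 1)).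

Definition partial_expansion (l : nat) (N : R) : R :=
  ln N + sum_n_m (fun s => beta2 s / N ^ (2 * s)) 1 (l - 1).

Lemma diff_op_ln_series (N : R) : 1 < N ->
  is_series (fun n => match n with O => 0 | S _ => - d 0 (n + 1) end
                      * (/ N) ^ (2 * n)) (diff_op ln N).
Proof.
intros HN.
pose proof (inv_gt1_bounds N HN) as Ht.
assert (HtP : Rabs (/ N) < 1) by (apply Rabs_def1; lra).
assert (HtN : Rabs (- / N) < 1) by (rewrite Rabs_Ropp; exact HtP).
pose proof (proj1 (is_pseries_R _ _ _) (log_series _ HtP)) as HF.
pose proof (proj1 (is_pseries_R _ _ _) (log_series _ HtN)) as HG.
pose proof (even_operator_series _ _ _ _ (proj1 Ht) HF HG) as H.
pose proof (is_series_opp _ _ H) as H'; clear H.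
match type of H' with is_series _ ?l => replace (diff_op ln N) with l end.
- revert H'; apply is_series_ext; intros n.
  change opp with Ropp; real_eq; rewrite <- Ropp_mult_distr_l_reverse.
  f_equal.
  destruct n as [|n].
  + simpl; unfold bin; simpl; field.
  + replace (2 * S n + 2)%nat with (S (2 * S n + 1)) by lia.
    replace (2 * S n + 1)%nat with (S (2 * S n)) by lia.
    replace (2 * S n)%nat with (S (2 * n + 1)) at 3 by lia.
    unfold PS_Int; rewrite !bin_0.
    unfold d; simpl (0 =? 0)%nat; cbv iota.
    pose proof (pos_INR n).
    rewrite (S_INR (S (2 * S n))), (S_INR (2 * S n)), !plus_INR, !mult_INR,
      (S_INR (2 * n + 1)), plus_INR, mult_INR, S_INR.
    simpl (INR 2); simpl (INR 1).
    rewrite ?(S_INR n);    field; repeat split; lra.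
- change opp with Ropp; unfold diff_op.
  replace (ln (N + 1)) with (ln N + ln (1 - - / N)).
  2:{ rewrite <- ln_mult by lra; f_equal; field; lra. }
  replace (ln (N - 1)) with (ln N + ln (1 - / N)).
  2:{ rewrite <- ln_mult by lra; f_equal; field; lra. }
  simpl PS_Int; real_eq; field; lra.
Qed.

Lemma diff_op_pow_series (j : nat) (N : R) : (1 <= j)%nat -> 1 < N ->
  is_series (fun n => (if (j <=? n)%nat then d j (n + 1) else 0)
                      * (/ N) ^ (2 * n)) (diff_op (fun x => / x ^ (2 * j)) N).
Proof.
intros Hj HN.
pose proof (inv_gt1_bounds N HN) as Ht.
assert (HtP : Rabs (/ N) < 1) by (apply Rabs_def1; lra).
assert (HtN : Rabs (- / N) < 1) by (rewrite Rabs_Ropp; exact HtP).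
pose proof (proj1 (is_pseries_R _ _ _) (bin_series (2 * j - 1) _ HtP)) as HF.
pose proof (proj1 (is_pseries_R _ _ _) (bin_series (2 * j - 1) _ HtN)) as HG.
pose proof (even_operator_series _ _ _ _ (proj1 Ht) HF HG) as H.
replace (S (2 * j - 1)) with (2 * j)%nat in H by lia.
pose proof (is_series_scal ((/ N) ^ (2 * j)) _ _ H) as H'; clear H.
assert (Hs : is_series (fun m => (if (j <=? j + m)%nat then d j (j + m + 1) else 0)
                      * (/ N) ^ (2 * (j + m)))
     (diff_op (fun x => / x ^ (2 * j)) N)).
{ match type of H' with is_series _ ?l =>
    replace (diff_op (fun x => / x ^ (2 * j)) N) with l end.
  - revert H'; apply is_series_ext; intros m.
    change scal with Rmult; real_eq.
    rewrite (proj2 (Nat.leb_le j (j + m))) by lia.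
    replace (2 * (j + m))%nat with (2 * j + 2 * m)%nat by lia.
    rewrite pow_add, <- !Rmult_assoc, (Rmult_comm ((/ N) ^ (2 * j))).
    do 2 f_equal.
    rewrite d_weight by lia.
    unfold weight, bin.
    replace (j + m - j)%nat with m by lia.
    replace (2 * j - 1 + (2 * m + 2))%nat with (S (S (2 * j + 2 * m - 1)))
      by lia.
    replace (2 * j - 1 + (2 * m + 1))%nat with (S (2 * j + 2 * m - 1))
      by lia.
    replace (2 * m + 2)%nat with (S (2 * m + 1)) by lia.
    replace (2 * (j + m) - 1)%nat with (2 * j + 2 * m - 1)%nat by lia.
    replace (2 * j - 1 + 2 * m)%nat with (2 * j + 2 * m - 1)%nat by lia.
    rewrite !fact_simpl, !mult_INR.
    replace (S (2 * j + 2 * m - 1)) with (2 * j + 2 * m)%nat by lia.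
    pose proof (INR_fact_neq_0 (2 * j + 2 * m - 1)).
    pose proof (INR_fact_neq_0 (2 * j - 1)).
    pose proof (INR_fact_neq_0 (2 * m + 1)).
    pose proof (INR_fact_neq_0 (2 * m)).
    pose proof (pos_INR m).
    rewrite !S_INR, !plus_INR, !mult_INR.
    simpl (INR 2); simpl (INR 1).
    destruct m as [|m].
    + simpl (INR 0) in *; field; repeat split; lra.
    + field; repeat split; lra.
  - change scal with Rmult; unfold diff_op.
    assert (E0 : bin (2 * j - 1) 0 = 1).
    { unfold bin; rewrite Nat.add_0_r; simpl (fact 0); simpl (INR 1).
      field; apply INR_fact_neq_0. }
    rewrite E0.
    replace (N + 1) with (N * (1 - - / N)) by (field; lra).
    replace (N - 1) with (N * (1 - / N)) by (field; lra).
    rewrite !Rpow_mult_distr, !Rinv_mult, pow_inv.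
    set (u := (1 - - / N) ^ (2 * j)); set (v := (1 - / N) ^ (2 * j)).
    assert (u <> 0) by (apply pow_nonzero; lra).
    assert (v <> 0) by (apply pow_nonzero; lra).
    assert (N ^ (2 * j) <> 0) by (apply pow_nonzero; lra).
    real_eq; field; repeat split; lra. }
apply is_series_decr_n with j; [lia|].
replace (plus _ _) with (diff_op (fun x => / x ^ (2 * j)) N); [exact Hs|].
rewrite (sum_n_ext_loc _ (fun _ => 0)).
- rewrite sum_n_const; change plus with Rplus; change opp with Ropp.
  real_eq; ring.
- intros n Hn; rewrite (proj2 (Nat.leb_gt j n)) by lia.
  real_eq; ring.
Qed.

Lemma diff_op_expansion_series (l : nat) (N : R) : 1 < N ->
  is_series (fun n =>
    (sum_n_m (fun j => if (j <=? n)%nat then d j (n + 1) * beta2 j else 0) 1 l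
     - match n with O => 0 | S _ => d 0 (n + 1) end) * (/ N) ^ (2 * n))
   (diff_op (partial_expansion (S l)) N).
Proof.
intros HN; induction l as [|l IH].
- pose proof (diff_op_ln_series N HN) as H.
  unfold diff_op, partial_expansion in *.
  rewrite !sum_n_m_zero by lia.
  change zero with 0; rewrite !Rplus_0_r.
  revert H; apply is_series_ext; intros n.
  rewrite sum_n_m_zero by lia; change zero with 0; real_eq.
  destruct n; ring.
- pose proof (diff_op_pow_series (S l) N ltac:(lia) HN) as H.
  pose proof (is_series_plus _ _ _ _ IH
    (is_series_scal (beta2 (S l)) _ _ H)) as H'.
  replace (diff_op (partial_expansion (S (S l))) N) with
    (plus (diff_op (partial_expansion (S l)) N)
      (scal (beta2 (S l)) (diff_op (fun x => / x ^ (2 * S l)) N))).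
  + revert H'; apply is_series_ext; intros n.
    rewrite sum_n_Sm by lia.
    change plus with Rplus; change scal with Rmult; real_eq.
    destruct (S l <=? n)%nat; ring.
  + unfold diff_op, partial_expansion.
    replace (S (S l) - 1)%nat with (S l) by lia.
    replace (S l - 1)%nat with l by lia.
    rewrite !(sum_n_Sm _ 1 l) by lia.
    change plus with Rplus; change scal with Rmult; unfold Rdiv; real_eq; ring.
Qed.

Lemma is_series_pos (u : nat -> R) (l : R) (m : nat) :
  (forall n, 0 <= u n) -> 0 < u m -> is_series u l -> 0 < l.
Proof.
intros Hu Hm Hs.
apply Rlt_le_trans with (sum_n u m).
- destruct m as [|m]; [rewrite sum_O; exact Hm|].
  rewrite sum_Sn; change plus with Rplus.
  assert (0 <= sum_n u m).
  { rewrite <- (Rmult_0_r (INR (S m))), <- sum_n_const.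
    apply sum_n_m_le; exact Hu. }
  lra.
- assert (Hlim : is_lim_seq (sum_n u) l) by exact Hs.
  apply (is_lim_seq_incr_compare _ _ Hlim).
  intros n; rewrite sum_Sn; change plus with Rplus; specialize (Hu (S n)); lra.
Qed.

(** The coefficients of index below [l] are zero and all the others have the same
sign, so the sum of the series has that sign, for every [N > 1]. *)
Lemma diff_op_expansion_sign (l : nat) (N : R) : (1 <= l)%nat -> 1 < N ->
  0 < (-1) ^ l * diff_op (partial_expansion l) N.
Proof.
intros Hl HN; destruct l as [|l]; [lia|].
pose proof (is_series_scal ((-1) ^ S l) _ _ (diff_op_expansion_series l N HN))
  as H.
assert (Hpow : forall n, 0 < (/ N) ^ (2 * n))
  by (intros; apply pow_lt, Rinv_0_lt_compat; lra).
assert (Hbig : forall n, (S l <= n)%nat -> 0 < (-1) ^ S l *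
  (sum_n_m (fun j => if (j <=? n)%nat then d j (n + 1) * beta2 j else 0) 1 l
     - match n with O => 0 | S _ => d 0 (n + 1) end)).
{ intros n Hn.
  rewrite (sum_n_m_ext_loc _ (fun j => d j (n + 1) * beta2 j)).
  - pose proof (residual_sign (S l) n ltac:(lia)) as Hr.
    replace (S l - 1)%nat with l in Hr by lia.
    destruct n; [lia|exact Hr].
  - intros j Hj; rewrite (proj2 (Nat.leb_le j n)) by lia; reflexivity. }
apply (is_series_pos _ _ (S l)) in H; [exact H| |].
- intros n; change scal with Rmult; rewrite <- Rmult_assoc.
  apply Rmult_le_pos; [|apply Rlt_le, Hpow].
  destruct (le_lt_dec (S l) n) as [Hn|Hn]; [apply Rlt_le, Hbig; exact Hn|].
  right.
  assert (Hz : sum_n_m (fun j => if (j <=? n)%nat then d j (n + 1) * beta2 j else 0) 1 l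
    = sum_n_m (fun j => d j (n + 1) * beta2 j) 1 n).
  { destruct (Nat.eq_dec n l) as [->|Hne].
    - apply sum_n_m_ext_loc; intros j Hj.
      rewrite (proj2 (Nat.leb_le j l)) by lia; reflexivity.
    - rewrite (sum_n_m_Chasles _ 1 n l) by lia.
      rewrite (sum_n_m_ext_loc _ (fun _ => 0) (S n)).
      + rewrite sum_n_m_const; change plus with Rplus.
        rewrite Rmult_0_r, Rplus_0_r.
        apply sum_n_m_ext_loc; intros j Hj.
        rewrite (proj2 (Nat.leb_le j n)) by lia; reflexivity.
      + intros j Hj; rewrite (proj2 (Nat.leb_gt j n)) by lia; reflexivity. }
  rewrite Hz; destruct n as [|n].
  + rewrite sum_n_m_zero by lia; change zero with 0; ring.
  + rewrite residual_vanishes by lia; ring.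
- change scal with Rmult; rewrite <- Rmult_assoc.
  apply Rmult_lt_0_compat; [apply Hbig; lia|apply Hpow].
Qed.

(** * Wallis integrals *)

Definition sin_int (m : nat) : R := RInt (fun t => sin t ^ m) 0 (PI / 2).
Definition log_int (m : nat) : R :=
  RInt (fun t => ln (1 + sin t) * sin t ^ m) 0 (PI / 2).

Lemma sin_range (t : R) : 0 <= t <= PI / 2 -> 0 <= sin t <= 1.
Proof.
intros Ht; split; [|apply SIN_bound].
apply sin_ge_0; pose proof PI_RGT_0; lra.
Qed.

Lemma min_max_PI2 (t : R) :
  Rmin 0 (PI / 2) <= t <= Rmax 0 (PI / 2) -> 0 <= t <= PI / 2.
Proof.
pose proof PI_RGT_0; rewrite Rmin_left, Rmax_right by lra; auto.
Qed.

Lemma ex_sin_int (m : nat) : ex_RInt (fun t => sin t ^ m) 0 (PI / 2).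
Proof.
apply (ex_RInt_continuous (V := R_CompleteNormedModule)); intros t _.
apply (ex_derive_continuous (fun t => sin t ^ m)); auto_derive; exact I.
Qed.

Lemma ex_log_int (m : nat) :
  ex_RInt (fun t => ln (1 + sin t) * sin t ^ m) 0 (PI / 2).
Proof.
apply (ex_RInt_continuous (V := R_CompleteNormedModule)); intros t Ht.
apply min_max_PI2, sin_range in Ht.
apply (ex_derive_continuous (fun t => ln (1 + sin t) * sin t ^ m)).
auto_derive; repeat split; lra.
Qed.

Lemma cos2 (t : R) : cos t * cos t = 1 - sin t * sin t.
Proof. pose proof (sin2_cos2 t) as H; unfold Rsqr in H; lra. Qed.

Lemma is_RInt_antiderivative (F f : R -> R) (v : R) :
  (forall t, 0 <= t <= PI / 2 -> is_derive F t (f t)) ->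
  (forall t, 0 <= t <= PI / 2 -> ex_derive f t) ->
  F (PI / 2) - F 0 = v ->
  is_RInt f 0 (PI / 2) v.
Proof.
intros HF Hf <-; apply (is_RInt_derive F).
- intros t Ht; apply HF, min_max_PI2, Ht.
- intros t Ht; apply (ex_derive_continuous f), Hf, min_max_PI2, Ht.
Qed.

Lemma is_RInt_eq (f : R -> R) (a b u v : R) :
  is_RInt f a b u -> is_RInt f a b v -> u = v.
Proof.
intros Hu Hv; rewrite <- (is_RInt_unique f a b u Hu).
apply is_RInt_unique, Hv.
Qed.

Lemma sin_int_0 : sin_int 0 = PI / 2.
Proof.
unfold sin_int; simpl; rewrite RInt_const; change scal with Rmult; real_eq; ring.
Qed.

Lemma sin_int_1 : sin_int 1 = 1.
Proof.
apply is_RInt_unique.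
apply (is_RInt_antiderivative (fun t => - cos t)).
- intros t _; auto_derive; [exact I|simpl; ring].
- intros t _; auto_derive; exact I.
- rewrite cos_PI2, cos_0; ring.
Qed.

Lemma sin_int_rec (m : nat) :
  (INR m + 2) * sin_int (S (S m)) = (INR m + 1) * sin_int m.
Proof.
assert (H : is_RInt (fun t => (INR m + 2) * sin t ^ S (S m)
    - (INR m + 1) * sin t ^ m) 0 (PI / 2) 0).
{ apply (is_RInt_antiderivative (fun t => - cos t * sin t ^ S m)).
  - intros t _; auto_derive; [exact I|].
    change (Nat.pred (S m)) with m; rewrite ?S_INR.
    change (match m with O => 1 | S _ => INR m + 1 end) with (INR (S m)).
    rewrite S_INR; simpl pow.
    transitivity (sin t * sin t * sin t ^ m
      - (INR m + 1) * ((cos t * cos t) * sin t ^ m)); [ring|].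
    rewrite cos2; ring.
  - intros t _; auto_derive; exact I.
  - rewrite cos_PI2, sin_0; simpl; ring. }
pose proof (is_RInt_minus _ _ _ _ _ _
  (is_RInt_scal _ _ _ (INR m + 2) _ (RInt_correct _ _ _ (ex_sin_int (S (S m)))))
  (is_RInt_scal _ _ _ (INR m + 1) _ (RInt_correct _ _ _ (ex_sin_int m)))) as H'.
apply Rminus_diag_uniq; symmetry; exact (is_RInt_eq _ _ _ _ _ H H').
Qed.

Lemma log_int_1 : log_int 1 = sin_int 0 - sin_int 1.
Proof.
assert (H : is_RInt (fun t => (sin t ^ 0 - sin t ^ 1)
    - ln (1 + sin t) * sin t ^ 1) 0 (PI / 2) 0).
{ apply (is_RInt_antiderivative (fun t => ln (1 + sin t) * cos t)).
  - intros t Ht; apply sin_range in Ht; auto_derive; [lra|]; simpl.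
    transitivity (cos t * cos t / (1 + sin t) - ln (1 + sin t) * sin t);
      [field; lra|].
    rewrite cos2; field; lra.
  - intros t Ht; apply sin_range in Ht; auto_derive; repeat split; lra.
  - rewrite cos_PI2, sin_0, Rplus_0_r, ln_1; ring. }
pose proof (is_RInt_minus _ _ _ _ _ _
  (is_RInt_minus _ _ _ _ _ _ (RInt_correct _ _ _ (ex_sin_int 0))
     (RInt_correct _ _ _ (ex_sin_int 1)))
  (RInt_correct _ _ _ (ex_log_int 1))) as H'.
symmetry; apply Rminus_diag_uniq; symmetry.
exact (is_RInt_eq _ _ _ _ _ H H').
Qed.

(** Integration by parts with the antiderivative [ln (1 + sin) * cos * sin^(m+1)]:
the factor [cos^2 / (1 + sin)] that appears is [1 - sin]. *)
Lemma log_int_rec (m : nat) :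
  (INR m + 2) * log_int (S (S m)) - (INR m + 1) * log_int m
  = sin_int (S m) - sin_int (S (S m)).
Proof.
assert (H : is_RInt (fun t => (sin t ^ S m - sin t ^ S (S m))
    - ((INR m + 2) * (ln (1 + sin t) * sin t ^ S (S m))
       - (INR m + 1) * (ln (1 + sin t) * sin t ^ m))) 0 (PI / 2) 0).
{ apply (is_RInt_antiderivative (fun t => ln (1 + sin t) * (cos t * sin t ^ S m))).
  - intros t Ht; apply sin_range in Ht; auto_derive; [lra|].
    change (Nat.pred (S m)) with m.
    change (match m with O => 1 | S _ => INR m + 1 end) with (INR (S m)).
    rewrite S_INR; simpl pow.
    transitivity (cos t * cos t / (1 + sin t) * (sin t * sin t ^ m)
      + ln (1 + sin t) * ((INR m + 1) * (cos t * cos t) * sin t ^ m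
        - sin t * (sin t * sin t ^ m)));
      [field; lra|].
    rewrite cos2; field; lra.
  - intros t Ht; apply sin_range in Ht; auto_derive; repeat split; lra.
  - rewrite cos_PI2, sin_0; simpl; ring. }
pose proof (is_RInt_minus _ _ _ _ _ _
  (is_RInt_minus _ _ _ _ _ _ (RInt_correct _ _ _ (ex_sin_int (S m)))
     (RInt_correct _ _ _ (ex_sin_int (S (S m)))))
  (is_RInt_minus _ _ _ _ _ _
  (is_RInt_scal _ _ _ (INR m + 2) _ (RInt_correct _ _ _ (ex_log_int (S (S m)))))
  (is_RInt_scal _ _ _ (INR m + 1) _ (RInt_correct _ _ _ (ex_log_int m))))) as H'.
symmetry; apply Rminus_diag_uniq; symmetry.
exact (is_RInt_eq _ _ _ _ _ H H').
Qed.

Lemma sin_int_decr (m : nat) : sin_int (S m) <= sin_int m.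
Proof.
pose proof PI_RGT_0.
apply RInt_le; [lra|apply ex_sin_int|apply ex_sin_int|].
intros t Ht; assert (Hs : 0 <= sin t <= 1) by (apply sin_range; lra).
simpl; rewrite <- (Rmult_1_l (sin t ^ m)) at 2.
apply Rmult_le_compat_r; [apply pow_le|]; lra.
Qed.

Lemma ln_le_sub1 (x : R) : 0 < x -> ln x <= x - 1.
Proof.
intros Hx; rewrite <- (ln_exp (x - 1)).
apply ln_le; [exact Hx|].
pose proof (exp_ineq1_le (x - 1)); lra.
Qed.

(** Both bounds are integrals of [ln 2 - (1 - s) <= ln (1 + s) <= ln 2] with [s = sin t]:
for large [m] the weight [sin^m] concentrates where [sin] is 1. *)
Lemma log_int_bounds (m : nat) :
  ln 2 * sin_int m - (sin_int m - sin_int (S m)) <= log_int m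
  <= ln 2 * sin_int m.
Proof.
pose proof PI_RGT_0.
assert (Hscal : is_RInt (fun t => ln 2 * sin t ^ m) 0 (PI / 2) (ln 2 * sin_int m))
  by apply (is_RInt_scal _ _ _ (ln 2) _ (RInt_correct _ _ _ (ex_sin_int m))).
pose proof (is_RInt_minus _ _ _ _ _ _ Hscal
  (is_RInt_minus _ _ _ _ _ _ (RInt_correct _ _ _ (ex_sin_int m))
     (RInt_correct _ _ _ (ex_sin_int (S m))))) as Hlow.
split.
- apply (is_RInt_le _ _ 0 (PI / 2) _ _ ltac:(lra) Hlow
    (RInt_correct _ _ _ (ex_log_int m))).
  intros t Ht; assert (Hs : 0 <= sin t <= 1) by (apply sin_range; lra).
  change minus with Rminus; simpl pow.
  assert (Hl : ln 2 - ln (1 + sin t) <= 1 - sin t).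
  { rewrite <- ln_div by lra.
    eapply Rle_trans; [apply ln_le_sub1, Rdiv_lt_0_compat; lra|].
    replace (2 / (1 + sin t) - 1) with ((1 - sin t) / (1 + sin t))
      by (field; lra).
    apply Rle_div_l; nra. }
  assert (Hp : 0 <= sin t ^ m) by (apply pow_le; lra).
  nra.
- apply (is_RInt_le _ _ 0 (PI / 2) _ _ ltac:(lra)
    (RInt_correct _ _ _ (ex_log_int m)) Hscal).
  intros t Ht; assert (Hs : 0 <= sin t <= 1) by (apply sin_range; lra).
  apply Rmult_le_compat_r; [apply pow_le; lra|apply ln_le; lra].
Qed.

Lemma odd_even_ratio_pos (k : nat) : 0 < odd_even_ratio k.
Proof.
induction k as [|k IH]; cbn [odd_even_ratio]; [lra|].
rewrite S_INR; pose proof (pos_INR k).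
apply Rmult_lt_0_compat; [exact IH|apply Rdiv_lt_0_compat; lra].
Qed.

Lemma odd_even_ratio_S (k : nat) :
  odd_even_ratio (S k) = odd_even_ratio k * ((2 * INR k + 1) / (2 * INR k + 2)).
Proof.
cbn [odd_even_ratio]; rewrite S_INR; pose proof (pos_INR k).
field; lra.
Qed.

Lemma INR_double (k : nat) : INR (2 * k) = 2 * INR k.
Proof. rewrite mult_INR; reflexivity. Qed.

Lemma sin_int_even (k : nat) : sin_int (2 * k) = PI / 2 * odd_even_ratio k.
Proof.
induction k as [|k IH]; [simpl (2 * 0)%nat; rewrite sin_int_0; simpl; ring|].
replace (2 * S k)%nat with (S (S (2 * k))) by lia.
pose proof (sin_int_rec (2 * k)) as H; rewrite IH, INR_double in H.
rewrite odd_even_ratio_S; pose proof (pos_INR k).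
apply (Rmult_eq_reg_l (2 * INR k + 2)); [|lra].
rewrite H; field; lra.
Qed.

Lemma sin_int_odd (k : nat) :
  (2 * INR k + 1) * odd_even_ratio k * sin_int (2 * k + 1) = 1.
Proof.
induction k as [|k IH]; [simpl (2 * 0 + 1)%nat; rewrite sin_int_1; simpl; ring|].
replace (2 * S k + 1)%nat with (S (S (2 * k + 1))) by lia.
pose proof (sin_int_rec (2 * k + 1)) as H.
rewrite plus_INR, INR_double in H; simpl (INR 1) in H.
rewrite odd_even_ratio_S, S_INR; pose proof (pos_INR k).
etransitivity; [|exact IH].
transitivity (odd_even_ratio k * ((2 * INR k + 1) / (2 * INR k + 2))
  * ((2 * INR k + 1 + 2) * sin_int (S (S (2 * k + 1))))); [ring|].
rewrite H; field; lra.
Qed.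

Lemma wallis_bounds (k : nat) :
  2 / (2 * INR k + 1) <= PI * odd_even_ratio k ^ 2
  <= 2 * (2 * INR k + 2) / (2 * INR k + 1) ^ 2.
Proof.
pose proof (sin_int_odd k) as Ho; pose proof (sin_int_even k) as He.
pose proof (sin_int_even (S k)) as He'.
pose proof (sin_int_decr (2 * k)) as H1; pose proof (sin_int_decr (2 * k + 1)) as H2.
replace (S (2 * k)) with (2 * k + 1)%nat in H1 by lia.
replace (S (2 * k + 1)) with (2 * S k)%nat in H2 by lia.
rewrite He in H1; rewrite He', odd_even_ratio_S in H2.
pose proof (odd_even_ratio_pos k) as Hc; pose proof (pos_INR k) as Hk.
set (c := odd_even_ratio k) in *; set (I := sin_int (2 * k + 1)) in *.
set (x := INR k) in *.
assert (HI : I = / ((2 * x + 1) * c)).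
{ apply (Rmult_eq_reg_l ((2 * x + 1) * c)); [|nra].
  rewrite Ho; field; lra. }
rewrite HI in H1, H2.
split.
- replace (2 / (2 * x + 1)) with (2 * c * / ((2 * x + 1) * c)) by (field; lra).
  apply (Rmult_le_compat_l (2 * c)) in H1; [|lra].
  eapply Rle_trans; [exact H1|]; right; field.
- apply (Rmult_le_compat_l (2 * c * (2 * x + 2) / (2 * x + 1))) in H2.
  2:{ apply Rdiv_le_0_compat; [|lra]; apply Rmult_le_pos; lra. }
  eapply Rle_trans; [|eapply Rle_trans; [exact H2|]]; right; field; lra.
Qed.

Lemma landau_S (n : nat) :
  landau (S n) = landau n + odd_even_ratio (S n) ^ 2.
Proof. unfold landau; rewrite sum_n_Sm by lia; reflexivity. Qed.

(** The sum of the [c_k * (sin_int (2k) - sin_int (2k+1))] telescopes to the first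
summand by [log_int_rec]; the second one collects the
[c_k * sin_int (2k+1) = 1/(2k+1)]. *)
Lemma landau_decomposition (n : nat) :
  PI * landau n = 2 * ((2 * INR n + 1) * odd_even_ratio n * log_int (2 * n + 1))
    + sum_n_m (fun k => 2 / (2 * INR k + 1)) 0 n.
Proof.
induction n as [|n IH].
- unfold landau; rewrite !sum_n_n; simpl (2 * 0 + 1)%nat.
  rewrite log_int_1, sin_int_0, sin_int_1; simpl; field.
- rewrite landau_S, Rmult_plus_distr_l, IH, (sum_n_Sm _ 0 n) by lia.
  change plus with Rplus.
  pose proof (log_int_rec (2 * n + 1)) as H.
  replace (2 * S n + 1)%nat with (S (S (2 * n + 1))) by lia.
  pose proof (sin_int_odd (S n)) as Ho; pose proof (sin_int_even (S n)) as He.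
  replace (2 * S n + 1)%nat with (S (S (2 * n + 1))) in Ho by lia.
  replace (2 * S n)%nat with (S (2 * n + 1)) in He by lia.
  rewrite He, plus_INR, INR_double in H; simpl (INR 1) in H.
  pose proof (pos_INR n); pose proof (odd_even_ratio_pos (S n)).
  assert (E : (2 * INR n + 1) * odd_even_ratio n
              = (2 * INR n + 2) * odd_even_ratio (S n)).
  { rewrite odd_even_ratio_S; field; lra. }
  rewrite E; rewrite S_INR in *.
  set (c := odd_even_ratio (S n)) in *.
  set (A := log_int (S (S (2 * n + 1)))) in *.
  set (I := sin_int (S (S (2 * n + 1)))) in *.
  replace (log_int (2 * n + 1)) with
    (((2 * INR n + 1 + 2) * A - (PI / 2 * c - I)) / (2 * INR n + 2))
    by (rewrite <- H; field; lra).
  replace (2 / (2 * (INR n + 1) + 1)) with (2 * c * I)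
    by (apply (Rmult_eq_reg_l (2 * (INR n + 1) + 1)); [|lra];
        transitivity (2 * ((2 * (INR n + 1) + 1) * c * I)); [ring|];
        rewrite Ho; field; lra).
  field; lra.
Qed.

(** * The constant term of the asymptotic expansion *)

Definition harmonic (n : nat) : R := sum_n_m (fun k => 1 / INR k) 1 n.

Lemma harmonic_S (n : nat) : harmonic (S n) = harmonic n + 1 / INR (S n).
Proof. unfold harmonic; rewrite sum_n_Sm by lia; reflexivity. Qed.

Lemma ln_ratio_bounds (x : R) : 0 < x ->
  / (x + 1) <= ln (x + 1) - ln x <= / x.
Proof.
intros Hx; rewrite <- ln_div by lra; split.
- replace ((x + 1) / x) with (/ (x / (x + 1))) by (field; lra).
  rewrite ln_Rinv by (apply Rdiv_lt_0_compat; lra).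
  pose proof (ln_le_sub1 (x / (x + 1)) ltac:(apply Rdiv_lt_0_compat; lra)).
  replace (/ (x + 1)) with (- (x / (x + 1) - 1)) by (field; lra); lra.
- replace (/ x) with ((x + 1) / x - 1) by (field; lra).
  apply ln_le_sub1, Rdiv_lt_0_compat; lra.
Qed.

Lemma euler_gamma_limit :
  is_lim_seq (fun n => harmonic (S n) - ln (INR (S n))) euler_gamma.
Proof.
assert (Hex : ex_finite_lim_seq (fun n => harmonic (S n) - ln (INR (S n)))).
{ apply ex_finite_lim_seq_decr with 0.
  - intros n; rewrite (harmonic_S (S n)), (S_INR (S n)).
    pose proof (lt_0_INR (S n) ltac:(lia)) as Hn.
    pose proof (ln_ratio_bounds (INR (S n)) Hn).
    unfold Rdiv; lra.
  - intros n.
    assert (H : ln (INR (S (S n))) <= harmonic (S n)).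
    { induction n as [|n IH].
      - unfold harmonic; rewrite sum_n_n; simpl.
        pose proof (ln_le_sub1 (1 + 1) ltac:(lra)); lra.
      - rewrite harmonic_S, (S_INR (S (S n))).
        pose proof (lt_0_INR (S (S n)) ltac:(lia)) as Hn.
        pose proof (ln_ratio_bounds (INR (S (S n))) Hn); unfold Rdiv; lra. }
    pose proof (lt_0_INR (S n) ltac:(lia)) as Hn.
    assert (ln (INR (S n)) <= ln (INR (S (S n))))
      by (apply ln_le; [exact Hn|apply le_INR; lia]).
    lra. }
destruct Hex as [g Hg].
assert (Hg' := Hg).
apply (is_lim_seq_incr_1 (fun n => harmonic n - ln (INR n)) g) in Hg'.
replace euler_gamma with g; [exact Hg|].
change (g = real (Lim_seq (fun n => harmonic n - ln (INR n)))).
rewrite (is_lim_seq_unique _ _ Hg'); reflexivity.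
Qed.

Lemma odd_harmonic (n : nat) :
  sum_n_m (fun k => 2 / (2 * INR k + 1)) 0 n
  = 2 * harmonic (2 * n + 2) - harmonic (S n).
Proof.
induction n as [|n IH].
- unfold harmonic; simpl (2 * 0 + 2)%nat.
  rewrite (sum_n_Sm _ 1 1) by lia; rewrite !sum_n_n.
  change plus with Rplus; simpl; real_eq; field.
- rewrite sum_n_Sm by lia; rewrite IH.
  replace (2 * S n + 2)%nat with (S (S (2 * n + 2))) by lia.
  rewrite !harmonic_S, !S_INR, plus_INR, INR_double.
  change plus with Rplus; simpl (INR 2).
  pose proof (pos_INR n); real_eq; field; lra.
Qed.

Lemma is_lim_seq_inv_S : is_lim_seq (fun n => / INR (S n)) 0.
Proof.
apply (is_lim_seq_incr_1 (fun n => / INR n) 0).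
apply (is_lim_seq_inv _ p_infty); [apply is_lim_seq_INR|discriminate].
Qed.

Lemma landau_log_limit :
  is_lim_seq (fun n => PI * landau n - ln (INR (S n)))
    (euler_gamma + 4 * ln 2).
Proof.
set (h := fun n => harmonic n - ln (INR n)).
assert (Hg : is_lim_seq (fun n => h (S n)) euler_gamma)
  by exact euler_gamma_limit.
assert (Hg2 : is_lim_seq (fun n => h (2 * n + 2)%nat) euler_gamma).
{ apply (is_lim_seq_ext (fun n => h (S (2 * n + 1)))).
  - intros n; f_equal; lia.
  - apply (is_lim_seq_subseq (fun n => h (S n)) euler_gamma
      (fun n => (2 * n + 1)%nat)); [|exact Hg].
    apply eventually_subseq; intros; lia. }
(* The factor in front of the integral normalises the weight [sin^(2n+1)], so
   [E n] is a mean value of [ln (1 + sin)]. *)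
set (E := fun n => (2 * INR n + 1) * odd_even_ratio n * log_int (2 * n + 1)).
assert (HE : is_lim_seq E (ln 2)).
{ apply (is_lim_seq_le_le (fun n => ln 2 - / INR (S n)) _ (fun _ => ln 2)).
  - intros n; unfold E.
    pose proof (log_int_bounds (2 * n + 1)) as [H1 H2].
    pose proof (sin_int_odd n) as Ho.
    pose proof (sin_int_even (S n)) as He.
    replace (2 * S n)%nat with (S (2 * n + 1)) in He by lia.
    pose proof (wallis_bounds n) as [Hw _].
    rewrite odd_even_ratio_S in He.
    pose proof (odd_even_ratio_pos n) as Hc; pose proof (pos_INR n) as Hn.
    set (c := odd_even_ratio n) in *; rewrite S_INR; set (x := INR n) in *.
    assert (Hcx : 0 < (2 * x + 1) * c) by (apply Rmult_lt_0_compat; lra).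
    apply (Rmult_le_compat_l ((2 * x + 1) * c)) in H1, H2; try lra.
    assert (H3 : (2 * x + 1) / (2 * x + 2)
              <= (2 * x + 1) * c * sin_int (S (2 * n + 1))).
    { rewrite He.
      apply (Rmult_le_compat_l ((2 * x + 1) ^ 2 / (2 * (2 * x + 2)))) in Hw.
      - eapply Rle_trans; [|eapply Rle_trans; [exact Hw|]];
          right; field; lra.
      - apply Rdiv_le_0_compat; [apply pow2_ge_0|lra]. }
    assert (H4 : 1 - / (x + 1) <= (2 * x + 1) / (2 * x + 2)).
    { replace ((2 * x + 1) / (2 * x + 2)) with (1 - / 2 * / (x + 1))
        by (field; lra).
      pose proof (Rinv_0_lt_compat (x + 1) ltac:(lra)); lra. }
    split.
    + eapply Rle_trans; [|exact H1].
      replace ((2 * x + 1) * c * (ln 2 * sin_int (2 * n + 1) -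
        (sin_int (2 * n + 1) - sin_int (S (2 * n + 1)))))
      with ((ln 2 - 1) * ((2 * x + 1) * c * sin_int (2 * n + 1))
            + (2 * x + 1) * c * sin_int (S (2 * n + 1))) by ring.
      rewrite Ho; lra.
    + eapply Rle_trans; [exact H2|].
      replace ((2 * x + 1) * c * (ln 2 * sin_int (2 * n + 1)))
        with (ln 2 * ((2 * x + 1) * c * sin_int (2 * n + 1))) by ring.
      rewrite Ho; lra.
  - replace (Finite (ln 2)) with (Finite (ln 2 - 0)) by (f_equal; ring).
    apply is_lim_seq_minus'; [apply is_lim_seq_const|apply is_lim_seq_inv_S].
  - apply is_lim_seq_const. }
apply (is_lim_seq_ext (fun n => 2 * E n + (2 * h (2 * n + 2)%nat - h (S n))
  + 2 * ln 2)).
- intros n; rewrite landau_decomposition, odd_harmonic; fold (E n); unfold h.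
  replace (INR (2 * n + 2)) with (2 * INR (S n))
    by (rewrite plus_INR, INR_double, S_INR; simpl; ring).
  rewrite ln_mult; [ring|lra|apply lt_0_INR; lia].
- replace (Finite (euler_gamma + 4 * ln 2)) with
    (Finite (2 * ln 2 + (2 * euler_gamma - euler_gamma) + 2 * ln 2))
    by (f_equal; ring).
  apply is_lim_seq_plus'; [|apply is_lim_seq_const].
  apply is_lim_seq_plus'; [|apply is_lim_seq_minus'; [|exact Hg]];
  apply (is_lim_seq_scal_l _ 2 (Finite _)); assumption.
Qed.

Definition shift (n : nat) : R := INR n + 3 / 4.

Lemma shift_pos (n : nat) : 0 < shift n.
Proof. unfold shift; pose proof (pos_INR n); lra. Qed.

Lemma shift_S (n : nat) : shift (S n) = shift n + 1.
Proof. unfold shift; rewrite S_INR; ring. Qed.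

Lemma is_lim_seq_inv_shift : is_lim_seq (fun n => / shift n) 0.
Proof.
apply (is_lim_seq_inv _ p_infty); [|discriminate].
apply (is_lim_seq_plus _ _ p_infty (3 / 4));
  [apply is_lim_seq_INR|apply is_lim_seq_const|reflexivity].
Qed.

Definition truncation_error (l n : nat) : R :=
  PI * landau n
  - (partial_expansion l (shift n) + euler_gamma + 4 * ln 2).

Lemma is_lim_seq_sum_n_m (u : nat -> nat -> R) (a b : nat) :
  (forall s, (a <= s <= b)%nat -> is_lim_seq (u s) 0) ->
  is_lim_seq (fun n => sum_n_m (fun s => u s n) a b) 0.
Proof.
intros Hu; destruct (le_lt_dec a b) as [Hab|Hab].
- induction b as [|b IH].
  + replace a with 0%nat by lia.
    apply (is_lim_seq_ext (u 0%nat)); [intros; now rewrite sum_n_n|].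
    apply Hu; lia.
  + destruct (Nat.eq_dec a (S b)) as [->|Hne].
    * apply (is_lim_seq_ext (u (S b))); [intros; now rewrite sum_n_n|].
      apply Hu; lia.
    * apply (is_lim_seq_ext (fun n => sum_n_m (fun s => u s n) a b + u (S b) n)).
      -- intros n; rewrite sum_n_Sm by lia; reflexivity.
      -- replace (Finite 0) with (Finite (0 + 0)) by (f_equal; ring).
         apply is_lim_seq_plus'; [apply IH; [|lia]|]; intros; apply Hu; lia.
- apply (is_lim_seq_ext (fun _ => 0)); [|apply is_lim_seq_const].
  intros n; rewrite sum_n_m_zero by lia; reflexivity.
Qed.

Lemma is_lim_seq_inv_shift_pow (s : nat) :
  is_lim_seq (fun n => / shift n ^ S s) 0.
Proof.
induction s as [|s IH].
- apply (is_lim_seq_ext (fun n => / shift n)); [|apply is_lim_seq_inv_shift].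
  intros n; now rewrite pow_1.
- apply (is_lim_seq_ext (fun n => / shift n * / shift n ^ S s)).
  + intros n; rewrite <- Rinv_mult; reflexivity.
  + replace (Finite 0) with (Finite (0 * 0)) by (f_equal; ring).
    apply is_lim_seq_mult'; [apply is_lim_seq_inv_shift|exact IH].
Qed.

Lemma truncation_error_limit (l : nat) : is_lim_seq (truncation_error l) 0.
Proof.
apply (is_lim_seq_ext (fun n =>
  (PI * landau n - ln (INR (S n))) - (euler_gamma + 4 * ln 2)
  + (ln (INR (S n)) - ln (shift n))
  - sum_n_m (fun s => beta2 s / shift n ^ (2 * s)) 1 (l - 1))).
- intros n; unfold truncation_error, partial_expansion; ring.
- replace (Finite 0) with
    (Finite ((euler_gamma + 4 * ln 2) - (euler_gamma + 4 * ln 2) + 0 - 0))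
    by (f_equal; ring).
  apply is_lim_seq_minus'; [apply is_lim_seq_plus'; [apply is_lim_seq_minus'|]|].
  + exact landau_log_limit.
  + apply is_lim_seq_const.
  + apply (is_lim_seq_le_le (fun _ => 0) _ (fun n => / shift n));
      [|apply is_lim_seq_const|apply is_lim_seq_inv_shift].
    intros n; pose proof (shift_pos n) as Hs.
    assert (shift n <= INR (S n) <= shift n + 1)
      by (unfold shift; rewrite S_INR; lra).
    pose proof (ln_ratio_bounds (shift n) Hs).
    pose proof (ln_le (shift n) (INR (S n)) ltac:(lra) ltac:(lra)).
    pose proof (ln_le (INR (S n)) (shift n + 1) ltac:(lra) ltac:(lra)).
    lra.
  + apply (is_lim_seq_sum_n_m (fun s n => beta2 s / shift n ^ (2 * s))).
    intros s Hs; replace (2 * s)%nat with (S (2 * s - 1)) by lia.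
    replace (Finite 0) with (Finite (beta2 s * 0)) by (f_equal; ring).
    apply is_lim_seq_mult'; [apply is_lim_seq_const|].
    apply is_lim_seq_inv_shift_pow.
Qed.

(** Each of [PI a_(n+1)] and [ln (N+1) - ln N] is [1/n + o(1/n)]. *)
Lemma truncation_increment_limit (l : nat) :
  is_lim_seq (fun n => INR (S n) *
    (truncation_error l (S n) - truncation_error l n)) 0.
Proof.
assert (Hr : is_lim_seq (fun n => INR (S n) * / shift n) 1).
{ apply (is_lim_seq_ext (fun n => 1 + / 4 * / shift n)).
  - intros n; pose proof (shift_pos n) as Hs; unfold shift in *.
    rewrite S_INR; field; lra.
  - replace (Finite 1) with (Finite (1 + / 4 * 0)) by (f_equal; ring).
    apply is_lim_seq_plus'; [apply is_lim_seq_const|].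
    apply is_lim_seq_mult'; [apply is_lim_seq_const|apply is_lim_seq_inv_shift]. }
apply (is_lim_seq_ext (fun n =>
  INR (S n) * (PI * odd_even_ratio (S n) ^ 2)
  - INR (S n) * (ln (shift (S n)) - ln (shift n))
  - INR (S n) *
     sum_n_m (fun s => beta2 s / shift (S n) ^ (2 * s)) 1 (l - 1)
  + INR (S n) *
     sum_n_m (fun s => beta2 s / shift n ^ (2 * s)) 1 (l - 1))).
{ intros n; unfold truncation_error, partial_expansion.
  rewrite landau_S; ring. }
replace (Finite 0) with (Finite (1 - 1 - 0 + 0)) by (f_equal; ring).
assert (HI : is_lim_seq (fun n => / INR (S n)) 0) by exact is_lim_seq_inv_S.
assert (Hsum : is_lim_seq (fun n => INR (S n) *
  sum_n_m (fun s => beta2 s / shift n ^ (2 * s)) 1 (l - 1)) 0).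
{ apply (is_lim_seq_ext (fun n =>
    sum_n_m (fun s => INR (S n) * (beta2 s / shift n ^ (2 * s))) 1 (l - 1))).
  - intros n; apply sum_scal.
  - apply (is_lim_seq_sum_n_m (fun s n => INR (S n) * (beta2 s / shift n ^ (2 * s)))).
    intros s Hs.
    apply (is_lim_seq_ext (fun n => beta2 s *
      ((INR (S n) * / shift n) * / shift n ^ S (2 * s - 2)))).
    + intros n; replace (2 * s)%nat with (S (S (2 * s - 2))) at 2 by lia.
      pose proof (shift_pos n).
      assert (shift n ^ S (2 * s - 2) <> 0) by (apply pow_nonzero; lra).
      change (shift n ^ S (S (2 * s - 2)))
        with (shift n * shift n ^ S (2 * s - 2)).
      field; split; lra.
    + replace (Finite 0) with (Finite (beta2 s * (1 * 0))) by (f_equal; ring).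
      apply is_lim_seq_mult'; [apply is_lim_seq_const|].
      apply is_lim_seq_mult'; [exact Hr|apply is_lim_seq_inv_shift_pow]. }
apply is_lim_seq_plus'; [apply is_lim_seq_minus'; [apply is_lim_seq_minus'|]|].
- apply (is_lim_seq_le_le
    (fun n => 1 - / INR (S n)) _ (fun n => 1 + / INR (S n))).
  + intros n; pose proof (wallis_bounds (S n)) as [H1 H2].
    pose proof (lt_0_INR (S n) ltac:(lia)) as Hx; set (x := INR (S n)) in *.
    apply (Rmult_le_compat_l x) in H1, H2; try lra.
    split.
    * eapply Rle_trans; [|exact H1].
      apply Rminus_le_0.
      replace (_ - _) with ((x + 1) / (x * (2 * x + 1))) by (field; lra).
      apply Rdiv_le_0_compat; [lra|apply Rmult_lt_0_compat; lra].
    * eapply Rle_trans; [exact H2|].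
      apply Rminus_le_0.
      replace (_ - _) with ((4 * x ^ 2 + 5 * x + 1) / (x * (2 * x + 1) ^ 2))
        by (field; lra).
      apply Rdiv_le_0_compat; [nra|].
      apply Rmult_lt_0_compat; [lra|apply pow_lt; lra].
  + replace (Finite 1) with (Finite (1 - 0)) by (f_equal; ring).
    apply is_lim_seq_minus'; [apply is_lim_seq_const|exact HI].
  + replace (Finite 1) with (Finite (1 + 0)) by (f_equal; ring).
    apply is_lim_seq_plus'; [apply is_lim_seq_const|exact HI].
- apply (is_lim_seq_le_le
    (fun n => 1 - / INR (S n)) _ (fun n => INR (S n) * / shift n));
    [| |exact Hr].
  + intros n; rewrite shift_S.
    pose proof (ln_ratio_bounds (shift n) (shift_pos n)) as [H1 H2].
    pose proof (lt_0_INR (S n) ltac:(lia)) as Hx.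
    apply (Rmult_le_compat_l (INR (S n))) in H1, H2; try lra.
    split; [|exact H2]; eapply Rle_trans; [|exact H1].
    unfold shift; rewrite S_INR in *; pose proof (pos_INR n).
    apply Rminus_le_0.
    replace (_ - _) with
      ((INR n / 4 + 1) / ((INR n + 1) * (INR n + 3 / 4 + 1)))
      by (field; lra).
    apply Rdiv_le_0_compat; [lra|apply Rmult_lt_0_compat; lra].
  + replace (Finite 1) with (Finite (1 - 0)) by (f_equal; ring).
    apply is_lim_seq_minus'; [apply is_lim_seq_const|exact HI].
- apply (is_lim_seq_ext (fun n => INR (S (S n)) *
     sum_n_m (fun s => beta2 s / shift (S n) ^ (2 * s)) 1 (l - 1)
    - sum_n_m (fun s => beta2 s / shift (S n) ^ (2 * s)) 1 (l - 1))).
  { intros n; rewrite (S_INR (S n)); ring. }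
  replace (Finite 0) with (Finite (0 - 0)) by (f_equal; ring).
  apply is_lim_seq_minus'.
  + apply (is_lim_seq_incr_1 _ 0) in Hsum; exact Hsum.
  + apply (is_lim_seq_sum_n_m (fun s n => beta2 s / shift (S n) ^ (2 * s))).
    intros s Hs; replace (2 * s)%nat with (S (2 * s - 1)) by lia.
    replace (Finite 0) with (Finite (beta2 s * 0)) by (f_equal; ring).
    apply is_lim_seq_mult'; [apply is_lim_seq_const|].
    apply (is_lim_seq_incr_1 (fun n => / shift n ^ S (2 * s - 1)) 0).
    apply is_lim_seq_inv_shift_pow.
- exact Hsum.
Qed.

(** * Sign of the truncation error *)

(** Reduction of order: the increments of [landau] solve the homogeneous equation, so
in this quotient the second-order equation of the error becomes of first order. *)
Definition scaled_increment (l n : nat) : R :=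
  (truncation_error l (S n) - truncation_error l n) / odd_even_ratio (S n) ^ 2.

Lemma scaled_increment_step (l n : nat) : (1 <= l)%nat ->
  0 < (-1) ^ (l + 1) * (scaled_increment l (S n) - scaled_increment l n).
Proof.
intros Hl.
pose proof (pos_INR n) as Hn.
assert (HN : 1 < shift (S n)) by (rewrite shift_S; unfold shift; lra).
pose proof (diff_op_expansion_sign l _ Hl HN) as Hsign.
pose proof (odd_even_ratio_pos (S n)) as Hc.
assert (E : scaled_increment l (S n) - scaled_increment l n
  = - diff_op (partial_expansion l) (shift (S n))
    / ((INR n + 3 / 2) ^ 2 * odd_even_ratio (S n) ^ 2)).
{ unfold scaled_increment, truncation_error, diff_op.
  replace (shift (S n) + 1) with (shift (S (S n))) by (rewrite !shift_S; ring).
  replace (shift (S n) - 1) with (shift n) by (rewrite !shift_S; ring).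
  rewrite (landau_S (S n)), (landau_S n), (odd_even_ratio_S (S n)).
  replace (shift (S n) + / 4) with (INR n + 2)
    by (rewrite shift_S; unfold shift; field).
  replace (shift (S n) - / 4) with (INR n + 3 / 2)
    by (rewrite shift_S; unfold shift; field).
  rewrite S_INR; field; repeat split; lra. }
rewrite E, pow_add, pow_1.
replace (_ * _) with ((-1) ^ l * diff_op (partial_expansion l) (shift (S n))
  / ((INR n + 3 / 2) ^ 2 * odd_even_ratio (S n) ^ 2))
  by (field; split; [lra|nra]).
apply Rdiv_lt_0_compat; [exact Hsign|].
apply Rmult_lt_0_compat; apply pow_lt; lra.
Qed.

Lemma scaled_increment_limit (l : nat) : is_lim_seq (scaled_increment l) 0.
Proof.
pose proof (truncation_increment_limit l) as H.
apply is_lim_seq_abs_0.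
apply (is_lim_seq_le_le (fun _ => 0) _ (fun n => 2 * PI * Rabs (INR (S n) *
    (truncation_error l (S n) - truncation_error l n)))).
- intros n; split; [apply Rabs_pos|].
  unfold scaled_increment.
  set (u := truncation_error l (S n) - truncation_error l n).
  pose proof (wallis_bounds (S n)) as [Hw _].
  pose proof (lt_0_INR (S n) ltac:(lia)) as Hx.
  assert (H1 : 1 <= INR (S n)) by (apply (le_INR 1); lia).
  pose proof (pow_lt _ 2 (odd_even_ratio_pos (S n))) as Hc.
  set (c := odd_even_ratio (S n) ^ 2) in *; set (x := INR (S n)) in *.
  pose proof PI_RGT_0.
  unfold Rdiv; rewrite !Rabs_mult, Rabs_inv, (Rabs_pos_eq c), (Rabs_pos_eq x)
    by lra.
  assert (Hi : / c <= 2 * PI * x).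
  { apply (Rmult_le_reg_r c); [exact Hc|].
    rewrite Rinv_l by lra.
    apply (Rmult_le_compat_l (2 * x)) in Hw; [|lra].
    assert (1 <= 2 * x * (2 / (2 * x + 1))).
    { apply Rminus_le_0.
      replace (_ - _) with ((2 * x - 1) / (2 * x + 1)) by (field; lra).
      apply Rdiv_le_0_compat; lra. }
    lra. }
  pose proof (Rabs_pos u).
  apply (Rmult_le_compat_l (Rabs u)) in Hi; lra.
- apply is_lim_seq_const.
- replace (Finite 0) with (Finite (2 * PI * 0)) by (f_equal; ring).
  apply is_lim_seq_mult'; [apply is_lim_seq_const|].
  apply (is_lim_seq_abs_0 (fun n => INR (S n) *
    (truncation_error l (S n) - truncation_error l n))); exact H.
Qed.

Lemma strict_incr_lim_0 (u : nat -> R) :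
  (forall n, u n < u (S n)) -> is_lim_seq u 0 -> forall n, u n < 0.
Proof.
intros Hu Hlim n.
apply Rlt_le_trans with (u (S n)); [apply Hu|].
apply (is_lim_seq_incr_compare u 0 Hlim); intros k; apply Rlt_le, Hu.
Qed.

Lemma truncation_error_sign (l n : nat) : (1 <= l)%nat ->
  0 < (-1) ^ (l + 1) * truncation_error l n.
Proof.
intros Hl; set (s := (-1) ^ (l + 1)).
assert (Hlim : forall u : nat -> R, is_lim_seq u 0 ->
  forall c, is_lim_seq (fun n => c * u n) 0).
{ intros u Hu c; replace (Finite 0) with (Finite (c * 0)) by (f_equal; ring).
  apply is_lim_seq_mult'; [apply is_lim_seq_const|exact Hu]. }
assert (Hinc : forall n, s * scaled_increment l n < 0).
{ apply (strict_incr_lim_0 (fun n => s * scaled_increment l n)).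
  - intros k; pose proof (scaled_increment_step l k Hl) as H; fold s in H; lra.
  - apply Hlim, scaled_increment_limit. }
assert (H : - s * truncation_error l n < 0).
{ apply (strict_incr_lim_0 (fun n => - s * truncation_error l n)).
  - intros k; specialize (Hinc k); unfold scaled_increment in Hinc.
    pose proof (pow_lt _ 2 (odd_even_ratio_pos (S k))) as Hc.
    apply (Rmult_lt_compat_r _ _ _ Hc) in Hinc.
    replace (s * ((truncation_error l (S k) - truncation_error l k)
      / odd_even_ratio (S k) ^ 2) * odd_even_ratio (S k) ^ 2)
    with (s * (truncation_error l (S k) - truncation_error l k)) in Hinc
      by (field; pose proof (odd_even_ratio_pos (S k)); lra).
    lra.
  - apply Hlim, truncation_error_limit. }
lra.
Qed.

Lemma truncation_error_S (l n : nat) : (1 <= l)%nat ->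
  truncation_error (S l) n
  = truncation_error l n - beta2 l / shift n ^ (2 * l).
Proof.
intros Hl; unfold truncation_error, partial_expansion.
replace (S l - 1)%nat with (S (l - 1)) by lia.
rewrite sum_n_Sm by lia; replace (S (l - 1)) with l by lia.
change plus with Rplus; ring.
Qed.

Theorem theorem2 (l n : nat) (hl : (1 <= l)%nat) :
  let N := INR n + 3 / 4 in
  let eps :=
    PI * landau n
    - (ln N + euler_gamma + 4 * ln 2
       + sum_n_m (fun s => beta2 s / N ^ (2 * s)) 1 (l - 1)) in
  0 < (-1) ^ (l + 1) * eps /\
  (-1) ^ (l + 1) * eps = Rabs eps /\
  Rabs eps < Rabs (beta2 l) / N ^ (2 * l) /\
  Rabs (beta2 l) / N ^ (2 * l) = (-1) ^ (l + 1) * beta2 l / N ^ (2 * l).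
Proof.
intros N eps.
assert (Heps : eps = truncation_error l n)
  by (unfold eps, truncation_error, partial_expansion; fold (shift n) in N;
      fold N; ring).
pose proof (truncation_error_sign l n hl) as H1.
pose proof (truncation_error_sign (S l) n ltac:(lia)) as H2.
rewrite truncation_error_S in H2 by exact hl.
rewrite <- Heps in H1, H2.
change (shift n) with N in H2.
replace (S l + 1)%nat with (S (l + 1)) in H2 by lia.
change ((-1) ^ S (l + 1)) with (-1 * (-1) ^ (l + 1)) in H2.
set (s := (-1) ^ (l + 1)) in *.
assert (HsA : Rabs s = 1) by apply pow_1_abs.
assert (Habs : forall x, 0 < s * x -> s * x = Rabs x).
{ intros x Hx; rewrite <- (Rabs_pos_eq (s * x)), Rabs_mult, HsA by lra; ring. }
assert (HN : 0 < N ^ (2 * l)) by (apply pow_lt, shift_pos).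
assert (Hb : s * eps < s * beta2 l / N ^ (2 * l)) by (unfold Rdiv in *; lra).
assert (Hbpos : 0 < s * beta2 l).
{ apply (Rmult_lt_reg_r (/ N ^ (2 * l))); [apply Rinv_0_lt_compat, HN|].
  unfold Rdiv in Hb; lra. }
rewrite <- (Habs _ Hbpos), <- (Habs _ H1).
repeat split; assumption || reflexivity.
Qed.
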